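(* Consider the single-parameter exponential family $f_\theta(y)=c(\theta)h(y)e^{\theta T(y)}$ described in the context, and assume that $\Theta_0=[a,b]$ and $\Theta=[-K,K]$ for some $K>\max\{|a|,|b|\}$, with $\Theta_1=\Theta\setminus\Theta_0$. Suppose that $g$ is continuously differentiable on $(0,1)$, continuous at $0$ and $1$, and $g'(t)>0$ for $0<t<1$, and that $T(y)$ takes more than two values, that is, $\mu(\{y\in\mathbb{Y}:T(y)\notin\{c_1,c_2\}\})>0$ for any $c_1,c_2\in\mathbb{R}$. Then there exists an optimal rule $\delta^*$ for the problem $$\max_{\delta\in\Delta}\int_{\Theta_1}g(p(\theta;\delta))\,\Lambda_1(d\theta)\quad\text{subject to } \sup_{\theta\in\Theta_0}p(\theta;\delta)\le\alpha$$ such that $\sup_{\theta\in[a,b]}p(\theta;\delta^* )=\alpha=\max\{p(a;\delta^* ),p(b;\delta^* )\}$ and, for some $-\infty\le\ell<u\le\infty$ and a measurable function $\gamma:\mathbb{Y}\to[0,1]$, for each $y\in\mathbb{Y}$, $$\delta^*(y)=\begin{cases}1,&T(y)>u\text{ or }T(y)<\ell\\ \gamma(y),&T(y)\in\{\ell,u\}\\ 0,&\ell<T(y)<u.\end{cases}$$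
   Context: Let $\mathbb{Y}\subset\mathbb{R}^{d_2}$ ($d_2\ge1$) and let $\mu$ be a $\sigma$-finite measure on $\mathbb{Y}$. Let $h:\mathbb{Y}\to[0,\infty)$ and $T:\mathbb{Y}\to\mathbb{R}$ be given measurable functions, and let $\mathcal{D}:=\{\theta\in\mathbb{R}: c(\theta)^{-1}:=\int_{\mathbb{Y}}h(y)e^{\theta T(y)}\,\mu(dy)<\infty\}$. Assume that $\mathcal{D}$ is open and that the compact parameter space $\Theta$ satisfies $\Theta\subset\mathcal{D}$. For $\theta\in\Theta$, $f_\theta(y)=c(\theta)h(y)e^{\theta T(y)}$ is a probability density with respect to $\mu$. $\Delta$ is the set of all randomized decision rules, i.e. measurable functions $\delta:\mathbb{Y}\to[0,1]$, and $p(\theta;\delta)=\int_{\mathbb{Y}}\delta(y)f_\theta(y)\,\mu(dy)$. Here $\alpha\in(0,1)$, $g:[0,1]\to\mathbb{R}$ is a measurable function, and $\Lambda_1$ is a probability measure on $\Theta_1$.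
   Formalization: The strict ℓ<u can fail; the formal theorem gives ℓ<u, or ℓ=u=c where T=c has probability at least 1−α under every θ in [a,b] and T takes values arbitrarily near c on both sides with positive probability. *)

(* Defs.v *)
From HB Require Import structures.
From mathcomp Require Import all_boot all_order all_algebra.
From mathcomp Require Import all_classical all_reals all_analysis.

Set Implicit Arguments.
Unset Strict Implicit.
Unset Printing Implicit Defensive.

Import Order.TTheory GRing.Theory Num.Theory.
Import numFieldNormedType.Exports.

Local Open Scope classical_set_scope.
Local Open Scope ring_scope.

(* A [measurableType] has to be pointed, so a subset [Y] of R^d is turned into
   a measurable space with the help of a point [y0] of [Y]. The sigma-algebra
   (Borel sets of R^d, intersected with [Y]) does not depend on [y0], and [Y]
   itself need not be Borel. *)
Section borel_subspace.
Context {R : realType} {d : nat}.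
Variables (Y : set (d.-tuple (measurableTypeR R))) (y0 : Y).

Definition pointed_subset of Y : Type := Y.

HB.instance Definition _ := Choice.on (pointed_subset y0).
HB.instance Definition _ := isPointed.Build (pointed_subset y0) y0.

Definition borel_subspace : measurableType _ :=
  g_sigma_algebra_preimageType
    (set_val : pointed_subset y0 -> d.-tuple (measurableTypeR R)).

End borel_subspace.

Section exponential_family.
Context {d : measure_display} {Y : measurableType d} {R : realType}.
Variables (mu : {measure set Y -> \bar R}) (h T : Y -> R).

(* 1 / c(theta), in [0, +oo] *)
Definition partition_function (theta : R) : \bar R :=
  (\int[mu]_y (h y * expR (theta * T y))%:E)%E.

Definition natural_domain : set R :=
  [set theta | (partition_function theta < +oo)%E].

Definition normalizer (theta : R) : R := (fine (partition_function theta))^-1.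

Definition density (theta : R) (y : Y) : R :=
  normalizer theta * h y * expR (theta * T y).

Definition decision_rule (delta : Y -> R) : Prop :=
  measurable_fun setT delta /\ (forall y, 0 <= delta y <= 1).

Definition power (theta : R) (delta : Y -> R) : R :=
  (\int[mu]_y (delta y * density theta y))%R.

Definition test_size (Theta0 : set R) (delta : Y -> R) : R :=
  sup [set power theta delta | theta in Theta0].

Definition objective (g : R -> R) (Lambda1 : probability (measurableTypeR R) R)
    (Theta1 : set R) (delta : Y -> R) : \bar R :=
  (\int[Lambda1]_(theta in Theta1) (g (power theta delta))%:E)%E.

Definition optimal_rule (g : R -> R)
    (Lambda1 : probability (measurableTypeR R) R)
    (Theta0 Theta1 : set R) (alpha : R) (delta : Y -> R) : Prop :=
  [/\ decision_rule delta, test_size Theta0 delta <= alpha &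
      forall delta', decision_rule delta' -> test_size Theta0 delta' <= alpha ->
        (objective g Lambda1 Theta1 delta' <= objective g Lambda1 Theta1 delta)%E].

Definition two_sided (l u : \bar R) (gamma delta : Y -> R) : Prop :=
  forall y, [/\ (u < (T y)%:E)%E \/ ((T y)%:E < l)%E -> delta y = 1,
                (T y)%:E = l \/ (T y)%:E = u -> delta y = gamma y &
                (l < (T y)%:E)%E /\ ((T y)%:E < u)%E -> delta y = 0].

(* [c] is an atom of T, of probability at least 1 - alpha under every theta in
   Theta0, that T charges arbitrarily closely from both sides. Then the best
   rule may accept on [T = c] only (l = u = c), as in the symmetric case
   Y = R, T(y) = y, h = 1, g(t) = t, mu = (9/10) dirac_0 + (1/10) U[-1, 1],
   [a, b] = [-1/2, 1/2], Lambda1 = (dirac_(-1) + dirac_1) / 2, alpha = 1/2;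
   no two-sided rule with l < u is optimal there. *)
Definition dominant_inner_atom (Theta0 : set R) (alpha c : R) : Prop :=
  forall theta, Theta0 theta ->
    1 - alpha <= power theta \1_[set y | T y = c] /\
    forall e, 0 < e ->
      0 < power theta \1_[set y | c - e < T y < c] /\
      0 < power theta \1_[set y | c < T y < c + e].

End exponential_family.

(* Main.v *)
Require Import Defs.
From HB Require Import structures.
From mathcomp Require Import all_boot all_order all_algebra.
From mathcomp Require Import all_classical all_reals all_analysis.
From mathcomp Require Import measurable_realfun.
From mathcomp Require Import lra ring.

Import Order.TTheory GRing.Theory Num.Theory.
Import numFieldNormedType.Exports.

Local Open Scope classical_set_scope.
Local Open Scope ring_scope.

(** Two-tailed rules form an essentially complete class, and they are
    parametrized by a compact triangle on which all powers are continuous; so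
    an optimum is found by maximizing a continuous function of two real
    variables.

    Take [f = density a] as base density: [density theta] is a constant times
    [expR ((theta - a) * T) * f]. In the coordinate [x = expR ((b - a) * T)]
    (or [x = T] if [a = b], see [chart]) the factor [expR ((theta - a) * T)] is
    the power [x `^ ((theta - a) / (b - a))]: it is convex in [x] for [theta]
    outside [[a, b]] and concave for [theta] inside. Hence if [phi] is 1 off
    [[l, u]] and 0 in its interior, and [delta] is any rule with the same
    integrals against [f] and [x * f] (when [a < b], the same powers at [a] and [b]),
    then [phi - delta] has the sign of the difference between
    [expR ((theta - a) * T)] and its chord through [l] and [u]; integrating,
    [phi] is at least as powerful as [delta] on the whole alternative
    ([two_tail_dominates]). Compared with a constant instead of [delta], the
    same argument with a concave function shows that the power of [phi] on
    [[a, b]] is at most its maximum at the two end points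
    ([two_tail_quasiconvex]).

    Such a [phi] exists for every [delta] of mass strictly between 0 and 1 under
    [f], and the other rules are trivial. Let [lower s] be the test that
    rejects for small [T] and has mass [s] under [f] ([quantile_exists]), and
    let [two_tail s v = 1 - (lower v - lower s)]. The integral against [f]
    fixes [v - s]; along this segment the integral against [x * f] is
    continuous, its values at both ends bracket that of [delta] by the
    Neyman-Pearson argument, and the intermediate value theorem applies
    ([two_tail_matches]). Continuity holds because the tests [lower s] are
    totally ordered, so that the difference of two of them is itself a rule
    with mass equal to the difference of the parameters ([lower_continuous]).

    The extreme value theorem now gives the best two-tailed rule of size at
    most [alpha], and it is optimal among all rules ([two_tail_optimum]). If its
    powers at [a] and [b] were both smaller than [alpha], mixing it with the
    rule 1 would increase the power at every [theta] while both stay at most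
    [alpha] ([two_tail_optimal_rule]). Finally, when the two
    thresholds coincide, the atom between them carries mass at least
    [1 - alpha]; unless [T] charges both of its sides arbitrarily closely, a
    threshold can be moved across a null interval ([two_tail_shape]). *)

(** * Convexity of exponentials relative to exponentials *)

Section three_exponentials.
Context {R : realType}.
Implicit Types (r s t l u : R).

(** Convexity of [expR] between 0 and [s]. *)
Lemma expR_interp_le r s : 0 <= r <= 1 ->
  expR (r * s) <= 1 + r * (expR s - 1).
Proof.
move=> r01.
have t01 : Itv.spec (@Itv.num_sem R) (Itv.Real `[0%Z, 1%Z]) r.
  by rewrite /Itv.spec /Itv.num_sem /= num_real in_itv /= r01.
have := @convex_expR R (Itv.mk t01) s 0.
rewrite !convRE /= mulr0 addr0 expR0 mulr1 /Itv.num_sem.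
move=> /le_trans; apply.
by rewrite mulrBr mulr1 /unstable.onem; lra.
Qed.

(** Again convexity of [expR]: for these [r], either 0 lies between [s] and [r * s],
    or [s] lies between 0 and [r * s]. *)
Lemma expR_interp_ge r s : r <= 0 \/ 1 <= r ->
  1 + r * (expR s - 1) <= expR (r * s).
Proof.
case=> [r0|r1].
  have d0 : 0 < 1 - r by lra.
  (* [0] lies between [r * s] and [s]: move the origin to [r * s]. *)
  have := @expR_interp_le (- r / (1 - r)) (s - r * s).
  have -> : - r / (1 - r) * (s - r * s) = - (r * s) by field; lra.
  have -> : 0 <= - r / (1 - r) <= 1.
    rewrite divr_ge0/= ?ler_pdivrMr; lra.
  move=> /(_ isT) h.
  have {h} := ler_wpM2r (mulr_ge0 (ltW d0) (expR_ge0 (r * s))) h.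
  have -> : expR (- (r * s)) * ((1 - r) * expR (r * s)) = 1 - r.
    by rewrite mulrCA -expRD addNr expR0 mulr1.
  have -> : (1 + - r / (1 - r) * (expR (s - r * s) - 1)) *
      ((1 - r) * expR (r * s)) =
      expR (r * s) - r * (expR (s - r * s) * expR (r * s)) by field; lra.
  by rewrite -expRD subrK; lra.
have r0 : 0 < r by lra.
have := @expR_interp_le (r^-1) (r * s).
rewrite mulKf ?gt_eqF// invr_ge0 (ltW r0) invf_le1//= => /(_ r1) h.
have {h} := ler_wpM2l (ltW r0) h.
have -> : r * (1 + r^-1 * (expR (r * s) - 1)) = r + expR (r * s) - 1.
  by field; lra.
lra.
Qed.

(** The hypothesis on [k] says that [y] is a convex function of [x], [k c] being a
    slope of support at [c]. The line is the chord through [l] and [u]; it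
    degenerates to the line of support when [l = u]. *)
Lemma chord_separation (x y k : R -> R) l u :
  (forall s t, s < t -> x s < x t) ->
  (forall c t, y c + k c * (x t - x c) <= y t) -> l <= u ->
  exists2 k1, (l = u -> k1 = k l) /\ k1 * (x u - x l) = y u - y l &
    (forall t, l <= t <= u -> y t <= y l + k1 * (x t - x l)) /\
    (forall t, t <= l \/ u <= t -> y l + k1 * (x t - x l) <= y t).
Proof.
move=> xS sup; rewrite le_eqVlt => /predU1P[<-|lu].
  exists (k l); first by split=> //; rewrite !subrr mulr0.
  split=> [t|t _]; last exact: sup.
  by rewrite -eq_le => /eqP <-; rewrite subrr mulr0 addr0.
have xlu := xS _ _ lu; have d0 : x u - x l != 0 by lra.
exists ((y u - y l) / (x u - x l)).
  by split; [move=> lu0; move: lu; rewrite lu0 ltxx|rewrite mulfVK].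
have xW s t : s <= t -> x s <= x t.
  by rewrite le_eqVlt => /predU1P[->//|/xS/ltW].
have dp : 0 < x u - x l by lra.
suff key : (forall t, l <= t <= u ->
      (y t - y l) * (x u - x l) <= (y u - y l) * (x t - x l)) /\
    (forall t, t <= l \/ u <= t ->
      (y u - y l) * (x t - x l) <= (y t - y l) * (x u - x l)).
  split=> t /[dup] ht; [move/(proj1 key)|move/(proj2 key)];
  rewrite -lerBDl ?lerBDl mulrAC.
  - by rewrite -lerBlDl ler_pdivlMr.
  - by rewrite -lerBrDl ler_pdivrMr.
split=> t.
  case/andP=> /xW h1 /xW h2; have := sup t l; have := sup t u; nra.
case=> /xW h.
  have := sup l t; have := sup l u; nra.
have := sup u t; have := sup u l; nra.
Qed.

(** Up to an affine change this is [(expR ((b - a) * t) - 1) / (b - a)], whose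
    limit is [t] as [b] tends to [a]: this is why one coordinate serves both for
    distinct and for equal end points. *)
Definition chart a b t : R := if a == b then t else expR ((b - a) * t).

Lemma chart_incr a b s t : a <= b -> s < t -> chart a b s < chart a b t.
Proof.
rewrite /chart le_eqVlt => /orP[->//|ab] st; rewrite lt_eqF//.
by rewrite ltr_expR ltr_pM2l// subr_gt0.
Qed.

Let expR_shift p c t : expR (p * t) = expR (p * c) * expR (p * (t - c)).
Proof. by rewrite -expRD -mulrDr addrC subrK. Qed.

(** The power function of exponent [(theta - a) / (b - a)] is convex when the
    exponent is negative or larger than 1; for [a = b], use [1 + t <= expR t]. *)
Lemma expR_convex_chart a b theta : a <= b -> theta < a \/ b < theta ->
  exists k : R -> R, forall c t,
    expR ((theta - a) * c) + k c * (chart a b t - chart a b c) <=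
      expR ((theta - a) * t).
Proof.
rewrite /chart le_eqVlt => /predU1P[<- _|ab out].
  exists (fun c => (theta - a) * expR ((theta - a) * c)) => c t.
  rewrite eqxx (expR_shift _ c t) mulrAC -{1}[expR _]mul1r -mulrDl mulrC.
  by rewrite ler_pM2l ?expR_gt0// expR_ge1Dx.
exists (fun c => (theta - a) / (b - a) * expR ((theta - a) * c - (b - a) * c)).
move=> c t; rewrite lt_eqF// (expR_shift (theta - a) c t) (expR_shift (b - a) c
  t).
have -> : (theta - a) * (t - c) = (theta - a) / (b - a) * ((b - a) * (t - c)).
  by field; lra.
have /(@expR_interp_ge _ ((b - a) * (t - c))) :
    (theta - a) / (b - a) <= 0 \/ 1 <= (theta - a) / (b - a).
  by case: out => ?; [left; rewrite ler_pdivrMr|right; rewrite ler_pdivlMr];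
    lra.
move/(ler_wpM2l (expR_ge0 ((theta - a) * c))); apply: le_trans.
have -> : expR ((theta - a) * c) =
    expR ((theta - a) * c - (b - a) * c) * expR ((b - a) * c).
  by rewrite -expRD subrK.
by rewrite le_eqVlt; apply/orP; left; apply/eqP; ring.
Qed.

Lemma expR_concave_chart a b theta : a < b -> a <= theta <= b ->
  forall c t, expR ((theta - a) * t) <= expR ((theta - a) * c) +
    (theta - a) / (b - a) * expR ((theta - a) * c - (b - a) * c) *
    (chart a b t - chart a b c).
Proof.
move=> ab inn c t.
rewrite /chart lt_eqF// (expR_shift (theta - a) c t) (expR_shift (b - a) c t).
have -> : (theta - a) * (t - c) = (theta - a) / (b - a) * ((b - a) * (t - c)).
  by field; lra.
have /(@expR_interp_le _ ((b - a) * (t - c))) :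
    0 <= (theta - a) / (b - a) <= 1.
  by rewrite ler_pdivlMr ?ler_pdivrMr; lra.
move/(ler_wpM2l (expR_ge0 ((theta - a) * c))) => /le_trans; apply.
have -> : expR ((theta - a) * c) =
    expR ((theta - a) * c - (b - a) * c) * expR ((b - a) * c).
  by rewrite -expRD subrK.
by rewrite le_eqVlt; apply/orP; left; apply/eqP; ring.
Qed.

(** Multiplied by [expR (a * t)], this is the combination of the exponentials of
    parameters [a] and [b] (of the first and its derivative in [a], if [a = b])
    that agrees with the one of parameter [theta] at both thresholds. *)
Lemma separation_outside a b theta l u : a <= b -> theta < a \/ b < theta ->
  l <= u -> exists k0 k1,
    (forall t, l <= t <= u ->
       expR ((theta - a) * t) <= k0 + k1 * chart a b t) /\
    (forall t, t <= l \/ u <= t ->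
       k0 + k1 * chart a b t <= expR ((theta - a) * t)).
Proof.
move=> ab out lu; have [k hk] := expR_convex_chart _ _ _ ab out.
have [k1 _ [h1 h2]] := chord_separation (chart a b)
  (fun t => expR ((theta - a) * t)) k _ _
  (fun s t => @chart_incr a b s t ab) hk lu.
exists (expR ((theta - a) * l) - k1 * chart a b l), k1; split=> t /[dup] ht.
  move/h1; lra.
move/h2; lra.
Qed.

(** When a threshold is infinite, the exponential of one end point is enough; when
    both are, zero coefficients do. The signs of the coefficients turn upper
    bounds on the integrals at [a] and [b] into one at [theta]. *)
Lemma separation_inside a b theta (l u : \bar R) :
  a <= b -> a <= theta <= b -> (l <= u)%E -> (l < +oo)%E -> (-oo < u)%E ->
  exists k0 k1, [/\ 0 <= k0, 0 <= k1,
    (forall t, (l <= t%:E)%E /\ (t%:E <= u)%E ->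
       k0 + k1 * chart a b t <= expR ((theta - a) * t)) &
    (forall t, (t%:E <= l)%E \/ (u <= t%:E)%E ->
       expR ((theta - a) * t) <= k0 + k1 * chart a b t)].
Proof.
rewrite le_eqVlt => /predU1P[<- ath _ _ _|ab inn].
  have -> : theta = a by apply/eqP; rewrite eq_le andbC.
  by exists 1, 0; split=> // t _; rewrite subrr !mul0r expR0 addr0.
case: l u => [l| |] [u| |]//; rewrite ?lee_fin => lu _ _; last first.
- exists 0, 0; split=> // t.
    by rewrite mul0r addr0 expR_ge0.
  by rewrite leeNy_eq leye_eq => -[|].
- exists 0, (expR ((theta - b) * u)); split; rewrite ?expR_ge0// => t;
  rewrite /chart lt_eqF// -expRD add0r ler_expR lee_fin.
    by case=> _; nra.
  by rewrite leeNy_eq/= => -[//|]; nra.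
- exists (expR ((theta - a) * l)), 0; split; rewrite ?expR_ge0// => t;
  rewrite mul0r addr0 ler_expR lee_fin.
    by case=> + _; nra.
  by rewrite leye_eq/= => -[|//]; nra.
have incr s t : s < t -> chart a b s < chart a b t.
  exact: chart_incr (ltW ab).
have [k1 [k1c k1x] [h1 h2]] := chord_separation (chart a b)
  (fun t => - expR ((theta - a) * t))
  (fun c => - ((theta - a) / (b - a) * expR ((theta - a) * c - (b - a) * c)))
  _ _ incr (fun c t => ltac:(
    have := expR_concave_chart _ _ _ ab inn c t; lra)) lu.
have r01 : 0 <= (theta - a) / (b - a) <= 1.
  by rewrite ler_pdivlMr ?ler_pdivrMr; lra.
(* [k0] is the value of the chord at [chart = 0]: up to the factor
   [chart u - chart l], it is a difference of two exponentials, whose exponents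
   compare because [theta <= b]. *)
exists (expR ((theta - a) * l) + k1 * chart a b l), (- k1); split.
- move: lu; rewrite le_eqVlt => /predU1P[lu|lu].
    rewrite (k1c lu) /= /chart lt_eqF// mulNr -[X in _ - X]mulrA -expRD subrK.
    by rewrite -{1}[expR _]mul1r -mulrBl mulr_ge0 ?expR_ge0// subr_ge0; lra.
  have xlu := incr _ _ lu.
  have : 0 <= (expR ((theta - a) * l) + k1 * chart a b l) *
     (chart a b u - chart a b l).
    have -> : (expR ((theta - a) * l) + k1 * chart a b l) *
        (chart a b u - chart a b l) =
       expR ((theta - a) * l) * chart a b u -
         expR ((theta - a) * u) * chart a b l.
      by rewrite mulrDl mulrAC k1x; ring.
    by rewrite /chart lt_eqF// -!expRD subr_ge0 ler_expR; nra.
  by rewrite pmulr_lge0// subr_gt0.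
- move: lu; rewrite oppr_ge0 le_eqVlt => /predU1P[lu|lu].
    by rewrite (k1c lu) oppr_le0 mulr_ge0 ?expR_ge0//; lra.
  have xlu := incr _ _ lu.
  have : k1 * (chart a b u - chart a b l) <= 0.
    rewrite k1x opprK addrC subr_le0 ler_expR; nra.
  by rewrite pmulr_lle0// subr_gt0.
- move=> t; rewrite !lee_fin => -[lt tu].
  have := h1 t; rewrite lt tu => /(_ isT); lra.
- move=> t; rewrite !lee_fin => /h2; lra.
Qed.

End three_exponentials.

(** * Integrals of tests *)

Section pairing.
Context {d : measure_display} {Y : measurableType d} {R : realType}.
Variable mu : {measure set Y -> \bar R}.
Implicit Types (phi psi f g w : Y -> R).

(** Differences of decision rules are test functions. *)
Definition test_function phi :=
  measurable_fun setT phi /\ forall y, `|phi y| <= 1.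

Definition L1 f := mu.-integrable setT (EFin \o f).

(** The power at [theta] is the pairing with [density theta]. General integrands
    are needed for [x(T) * f] and for the tilted densities. *)
Definition pairing phi f : R := (\int[mu]_y (phi y * f y))%R.

Lemma decision_rule_test phi : decision_rule phi -> test_function phi.
Proof. by case=> m h; split=> // y; rewrite ger0_norm; case/andP: (h y). Qed.

Lemma decision_ruleB phi psi : decision_rule phi -> decision_rule psi ->
  test_function (fun y => phi y - psi y).
Proof.
move=> [mphi h1] [mpsi h2]; split; first exact: measurable_funB.
by move=> y; rewrite ler_norml; have := h1 y; have := h2 y; lra.
Qed.

Lemma L1_measurable f : L1 f -> measurable_fun setT f.
Proof. by move/measurable_int/measurable_EFinP. Qed.

Lemma L1_le f g : measurable_fun setT f -> (forall y, `|f y| <= g y) ->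
  L1 g -> L1 f.
Proof.
move=> mf fg; apply: le_integrable => //; first exact/measurable_EFinP.
move=> y _ /=; rewrite lee_fin (le_trans (fg y))//; exact: ler_norm.
Qed.

Lemma L1D f g : L1 f -> L1 g -> L1 (fun y => f y + g y).
Proof. by move=> hf hg; have := integrableD measurableT hf hg. Qed.

Lemma L1B f g : L1 f -> L1 g -> L1 (fun y => f y - g y).
Proof. by move=> hf hg; have := integrableB measurableT hf hg. Qed.

Lemma L1Z (c : R) f : L1 f -> L1 (fun y => c * f y).
Proof. by move=> hf; have := integrableZl measurableT c hf. Qed.

Lemma L1_test phi f : test_function phi -> L1 f -> L1 (fun y => phi y * f y).
Proof.
move=> [mphi b] hf; apply: (@L1_le _ (fun y => `|f y|)).
- by apply: measurable_funM => //; exact: L1_measurable.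
- by move=> y; rewrite normrM ler_piMl.
- exact: integrable_norm.
Qed.

Lemma pairingBl phi psi f : test_function phi -> test_function psi -> L1 f ->
  pairing (fun y => phi y - psi y) f = pairing phi f - pairing psi f.
Proof.
move=> hphi hpsi hf; rewrite /pairing -RintegralB//; [|exact: L1_test..].
by apply: eq_Rintegral => y _; rewrite mulrBl.
Qed.

Lemma pairingDr phi f g : test_function phi -> L1 f -> L1 g ->
  pairing phi (fun y => f y + g y) = pairing phi f + pairing phi g.
Proof.
move=> hphi hf hg; rewrite /pairing -RintegralD//; [|exact: L1_test..].
by apply: eq_Rintegral => y _; rewrite mulrDr.
Qed.

Lemma pairingZr (c : R) phi f : test_function phi -> L1 f ->
  pairing phi (fun y => c * f y) = c * pairing phi f.
Proof.
move=> hphi hf; rewrite /pairing -RintegralZl//; last exact: L1_test.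
by apply: eq_Rintegral => y _; rewrite mulrCA.
Qed.

Lemma pairingZl (c : R) phi f : test_function phi -> L1 f ->
  pairing (fun y => c * phi y) f = c * pairing phi f.
Proof.
move=> hphi hf; rewrite /pairing -RintegralZl//; last exact: L1_test.
by apply: eq_Rintegral => y _; rewrite mulrA.
Qed.

Lemma pairing_ge0 phi f : (forall y, 0 <= phi y * f y) -> 0 <= pairing phi f.
Proof. by move=> h; exact: Rintegral_ge0. Qed.

Lemma pairing_cvg (phi_ : nat -> Y -> R) phi f :
  (forall n, test_function (phi_ n)) -> test_function phi -> L1 f ->
  (forall y, phi_ n y @[n --> \oo] --> phi y) ->
  pairing (phi_ n) f @[n --> \oo] --> pairing phi f.
Proof.
move=> h_ h hf cv; apply: fine_cvg.
have fin := integrable_fin_num measurableT (L1_test _ _ h hf).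
rewrite fineK//.
have mphif n : measurable_fun setT (fun y => (phi_ n y * f y)%:E).
  exact/measurable_EFinP/L1_measurable/L1_test.
have mf : measurable_fun setT (fun y => (phi y * f y)%:E).
  exact/measurable_EFinP/L1_measurable/L1_test.
have cv' : {ae mu, forall y, [set: Y] y ->
    (phi_ n y * f y)%:E @[n --> \oo] --> (phi y * f y)%:E}.
  apply: aeW => y _; apply: cvg_EFin; first exact: nearW.
  by apply: cvgMl; exact: cv.
have dom : {ae mu, forall y n, [set: Y] y ->
    (`|(phi_ n y * f y)%:E| <= (`|f y|)%:E)%E}.
  by apply: aeW => y n _; rewrite /= lee_fin normrM ler_piMl//; case: (h_ n).
have [_ _ ] := @dominated_convergence _ _ _ mu setT measurableT
  (fun n y => (phi_ n y * f y)%:E) (fun y => (phi y * f y)%:E)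
  (fun y => `|f y|%:E) mphif mf cv' (integrable_norm hf) dom.
exact.
Qed.

(** A nonnegative integrand of integral 0 vanishes almost everywhere, and then so
    does every integrand that vanishes with it. *)
Lemma pairing_null phi psi f g : test_function phi -> L1 f ->
  test_function psi -> L1 g -> (forall y, 0 <= phi y * f y) ->
  pairing phi f = 0 -> (forall y, phi y * f y = 0 -> psi y * g y = 0) ->
  pairing psi g = 0.
Proof.
move=> hphi hf hpsi hg ge0 int0 sub.
have L := L1_test _ _ hphi hf; have L' := L1_test _ _ hpsi hg.
have mf := measurable_int _ L; have mg := measurable_int _ L'.
have h0 : ae_eq mu setT (EFin \o (fun y => phi y * f y)) (cst 0%E).
  apply/(ae_eq_integral_abs mu measurableT mf).
  under eq_integral => y _ do rewrite /= ger0_norm//.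
  have := integrable_fin_num measurableT L => /fineK <-.
  by move: int0; rewrite /pairing /Rintegral/= => ->.
rewrite /pairing /Rintegral.
rewrite (@ae_eq_integral _ _ _ mu setT (cst 0%E))//.
  by rewrite integral0.
apply: filterS h0 => y h Dy; have := h Dy; rewrite /= => -[]/sub ->//.
Qed.

(** Truncate [w] at a high level [M]: where [`|w| <= M] the integral is at most
    [M] times that of [phi * f], and the rest is small uniformly in [phi]. *)
Lemma pairing_uniformly_integrable w f (e : R) : 0 < e ->
  (forall y, 0 <= f y) -> L1 f -> measurable_fun setT w ->
  L1 (fun y => w y * f y) ->
  exists2 M, 0 <= M & forall phi, decision_rule phi ->
    `|pairing phi (fun y => w y * f y)| <= M * pairing phi f + e.
Proof.
move=> e0 f0 Lf mw Lwf.
pose psi (n : nat) y : R := if n%:R < `|w y| then 1 else 0.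
have rpsi n : decision_rule (psi n).
  split; last by move=> y; rewrite /psi; case: ifP; rewrite ?lexx ?ler01.
  apply: measurable_fun_ifT => //; apply: measurable_fun_ltr => //.
  exact: measurableT_comp.
have Lnwf : L1 (fun y => `|w y| * f y).
  have := integrable_norm Lwf; rewrite /L1; apply: eq_integrable => // y _ /=.
  by rewrite normrM (ger0_norm (f0 y)).
have psi_cvg y : psi n y @[n --> \oo] --> (0 : R).
  apply: cvg_near_cst.
  near=> n; rewrite /psi ltNge ifF//; apply/negbTE; rewrite negbK.
  by near: n; exact: nbhs_infty_ger.
have zero_test : test_function (fun=> 0).
  by split=> [|y]; [exact: measurable_cst|rewrite normr0].
have := @pairing_cvg psi _ _ (fun n => decision_rule_test _ (rpsi n))
  zero_test Lnwf psi_cvg.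
have -> : pairing (fun=> 0) (fun y => `|w y| * f y) = 0.
  rewrite /pairing; under eq_Rintegral => y _ do rewrite mul0r.
  by rewrite Rintegral_cst// mul0r.
move=> /cvgr_lt /(_ e e0) [n _ /(_ n (leqnn n)) /= small].
exists n%:R => // phi rphi; have tphi := decision_rule_test _ rphi.
apply: le_trans (_ : _ <= n%:R * pairing phi f +
  pairing (psi n) (fun y => `|w y| * f y)) _; last by rewrite lerD2l ltW.
apply: (le_trans (le_normr_Rintegral _ _)) => //; first exact: L1_test.
rewrite -pairingZr// /pairing -RintegralD//; [|exact/L1_test/L1Z|]; last first.
  by apply: L1_test => //; exact: decision_rule_test.
apply: le_Rintegral => //.
- exact/integrable_norm/L1_test.
- by apply: L1D; [exact/L1_test/L1Z|apply: L1_test => //;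
  exact: decision_rule_test].
move=> y _; case: rphi => _ /(_ y) /andP[p0 p1].
rewrite !normrM (ger0_norm (f0 y)) (ger0_norm p0) !mulrA -mulrDl.
rewrite ler_wpM2r// /psi.
have := normr_ge0 (w y); have n0 : 0 <= n%:R :> R by [].
by case: ltP => h; nra.
Unshelve. all: by end_near.
Qed.

End pairing.

(** * One-sided tests of a given mass *)

Section lower_tests.
Context {d : measure_display} {Y : measurableType d} {R : realType}.
Variables (mu : {measure set Y -> \bar R}) (T f : Y -> R).
Hypotheses (mT : measurable_fun setT T) (f_ge0 : forall y, 0 <= f y).
Hypotheses (f_L1 : L1 mu f) (f_prob : pairing mu (fun=> 1) f = 1).
Implicit Types (p q : \bar R * R) (s t : R).

(** The test that rejects for small [T], randomized at its threshold. The threshold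
    may be infinite, so that the rules 0 and 1 are included. *)
Definition lower_test p (y : Y) : R :=
  if ((T y)%:E < p.1)%E then 1 else if (T y)%:E == p.1 then p.2 else 0.

Lemma lower_test_rule p : 0 <= p.2 <= 1 -> decision_rule (lower_test p).
Proof.
move=> p01; split; last first.
  by move=> y; rewrite /lower_test; case: ifP => _; [|case: ifP => _ //];
    rewrite ?ler01 lexx.
have mE : measurable_fun setT (fun y => (T y)%:E) by exact/measurable_EFinP.
apply: measurable_fun_ifT => //; first exact: measurable_fun_lte.
apply: measurable_fun_ifT => //.
rewrite [X in measurable_fun _ X](_ : _ =
  (fun y => ((T y)%:E <= p.1)%E && (p.1 <= (T y)%:E)%E)).
  by apply: measurable_and; exact: measurable_fun_lee.
by apply/funext => y; rewrite eq_le.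
Qed.

Lemma lower_test_le p q : 0 <= p.2 <= 1 -> 0 <= q.2 <= 1 ->
  (p.1 < q.1)%E \/ p.1 = q.1 /\ p.2 <= q.2 ->
  forall y, lower_test p y <= lower_test q y.
Proof.
move=> /andP[p0 p1] /andP[q0 q1] pq y; rewrite /lower_test.
case: pq => [pq|[-> pq]]; last by case: ifP => // _; case: ifP.
case: ifP => [/lt_trans ->//|_].
by case: ifP => [/eqP ->|_]; [rewrite pq|case: ifP => // _; case: ifP].
Qed.

(** Tests with the same orientation are ordered pointwise by their threshold, and
    at equal thresholds by their randomization. *)
Lemma lower_test_total p q : 0 <= p.2 <= 1 -> 0 <= q.2 <= 1 ->
  ((p.1 <= q.1)%E /\ forall y, lower_test p y <= lower_test q y) \/
  ((q.1 <= p.1)%E /\ forall y, lower_test q y <= lower_test p y).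
Proof.
move=> hp hq; case: (ltgtP p.1 q.1) => h.
- by left; split; [|apply: lower_test_le => //; left].
- by right; split; [|apply: lower_test_le => //; left].
- case: (leP p.2 q.2) => [h2|/ltW h2]; [left|right]; split => //;
    by apply: lower_test_le => //; right.
Qed.

Let P p := pairing mu (lower_test p) f.

Let P_le p q : 0 <= p.2 <= 1 -> 0 <= q.2 <= 1 ->
  (forall y, lower_test p y <= lower_test q y) -> P p <= P q.
Proof.
move=> hp hq le; have tp := decision_rule_test _ (lower_test_rule _ hp).
have tq := decision_rule_test _ (lower_test_rule _ hq).
rewrite -subr_ge0 -pairingBl//; apply: pairing_ge0 => y.
by rewrite mulr_ge0// subr_ge0.
Qed.

Let i0 : (0 <= (0:R) <= 1). Proof. by rewrite lexx ler01. Qed.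
Let i1 : (0 <= (1:R) <= 1). Proof. by rewrite lexx ler01. Qed.

Let P_cvg (p_ : nat -> \bar R * R) (phi : Y -> R) : (forall n, 0 <= (p_ n).2 <=
  1) ->
  decision_rule phi ->
  (forall y, \forall n \near \oo, lower_test (p_ n) y = phi y) ->
  P (p_ n) @[n --> \oo] --> pairing mu phi f.
Proof.
move=> hp rphi cv; apply: pairing_cvg => //.
- by move=> n; exact/decision_rule_test/lower_test_rule.
- exact: decision_rule_test.
- by move=> y; exact: cvg_near_cst.
Qed.

(** At the quantile [l] of order [s], the mass of [T < l] is at most [s] and that
    of [T <= l] at least [s]; randomizing on [T = l] interpolates between them. *)
Lemma quantile_exists s : 0 <= s <= 1 -> exists p,
  0 <= p.2 <= 1 /\ pairing mu (lower_test p) f = s.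
Proof.
move=> /andP[]; rewrite le_eqVlt => /predU1P[<- _|s0].
  (* When [T] is unbounded, the masses 0 and 1 need infinite thresholds. *)
  exists (-oo%E, 0); split; rewrite ?lexx ?ler01//.
  rewrite /pairing; under eq_Rintegral => y _.
    rewrite /lower_test/= mul0r; over.
  by rewrite Rintegral_cst// mul0r.
rewrite le_eqVlt => /predU1P[->|s1].
  exists (+oo%E, 0); split; rewrite ?lexx ?ler01//.
  by rewrite -[RHS]f_prob; apply: eq_Rintegral => y _;
    rewrite /lower_test/= ltry.
pose E := [set t | s <= P (t%:E, 1)].
have Pmono t t' : t <= t' -> P (t%:E, 1) <= P (t'%:E, 1).
  move=> tt'; apply: P_le => //; apply: lower_test_le => //=.
  by move: tt'; rewrite le_eqVlt lte_fin => /predU1P[->|]; [right|left].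
have E0 : E !=set0.
  have : P (n%:R%:E, 1) @[n --> \oo] --> pairing mu (fun=> 1) f.
    apply: P_cvg; [by move=> ?; exact: i1| |].
      by split=> [|y]; [exact: measurable_cst|rewrite ler01 lexx].
    move=> y; near=> n; rewrite /lower_test/= lte_fin ifT//.
    by near: n; exact: nbhs_infty_gtr.
  rewrite f_prob => /cvgr_gt/(_ s s1)[n _ /(_ n (leqnn n))/= h].
  by exists n%:R; exact: ltW.
have Elb : has_lbound E.
  have : P ((- n%:R)%:E, 1) @[n --> \oo] --> pairing mu (fun=> 0) f.
    apply: P_cvg; [by move=> ?; exact: i1| |].
      by split=> [|y]; [exact: measurable_cst|rewrite ler01 lexx].
    move=> y; near=> n; rewrite /lower_test/= lte_fin eqe.
    have h : - n%:R < T y.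
      by rewrite ltrNl; near: n; exact: nbhs_infty_gtr.
    by rewrite ltNge (ltW h)/= gt_eqF.
  have -> : pairing mu (fun=> 0) f = 0.
    rewrite /pairing; under eq_Rintegral => y _ do rewrite mul0r.
    by rewrite Rintegral_cst// mul0r.
  move=> /cvgr_lt/(_ s s0)[n _ /(_ n (leqnn n))/= h].
  exists (- n%:R) => t; rewrite /E/= => st; rewrite leNgt; apply/negP => tn.
  by have := Pmono _ _ (ltW tn); lra.
(* [l] is the quantile: the mass of [T <= l] is at least [s] by continuity from
   the right, the mass of [T < l] at most [s] by continuity from the left. *)
pose l := inf E.
have Fl : s <= P (l%:E, 1).
  have cv : P ((l + n.+1%:R^-1)%:E, 1) @[n --> \oo] --> P (l%:E, 1).
    apply: P_cvg; [by move=> ?; exact: i1|exact: lower_test_rule|].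
    move=> y; case: (leP (T y) l) => Tl.
      near=> n; rewrite /lower_test/= !lte_fin !eqe.
      have h : T y < l + n.+1%:R^-1 by rewrite (le_lt_trans Tl)// ltrDl.
      by rewrite h; case: ltgtP Tl.
    near=> n; rewrite /lower_test/= !lte_fin !eqe.
    have h : l + n.+1%:R^-1 < T y.
      rewrite -ltrBrDl; near: n.
      have Tl0 : 0 < T y - l by rewrite subr_gt0.
      exact: (near_infty_natSinv_lt (PosNum Tl0)).
    by rewrite !ltNge (ltW h) (ltW Tl)/= !gt_eqF.
  apply: (cvgr_to_ge cv); apply: nearW => n.
  have [|t Et tl] := @inf_adherent _ E n.+1%:R^-1 _ (conj E0 Elb).
    by rewrite invr_gt0.
  by apply: (le_trans Et); apply: Pmono; exact: ltW.
have Gl : P (l%:E, 0) <= s.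
  have cv : P ((l - n.+1%:R^-1)%:E, 1) @[n --> \oo] --> P (l%:E, 0).
    apply: P_cvg; [by move=> ?; exact: i1|exact: lower_test_rule|].
    move=> y; case: (ltP (T y) l) => Tl; last first.
      near=> n; rewrite /lower_test/= !lte_fin !eqe.
      have h : l - n.+1%:R^-1 < T y by rewrite ltrBlDr ltr_pwDr.
      by rewrite !ltNge (ltW h) Tl/= gt_eqF//; case: ifP.
    near=> n; rewrite /lower_test/= !lte_fin !eqe.
    have h : T y < l - n.+1%:R^-1.
      rewrite ltrBrDl -ltrBrDr; near: n.
      have Tl0 : 0 < l - T y by rewrite subr_gt0.
      exact: (near_infty_natSinv_lt (PosNum Tl0)).
    by rewrite h Tl.
  apply: (cvgr_to_le cv); apply: nearW => n.
  rewrite leNgt; apply/negP => /ltW h.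
  have /(_ _ h) := @inf_lbound _ E Elb; apply/negP; rewrite -ltNge.
  by rewrite ltrBlDr ltrDl invr_gt0.
have mix g : P (l%:E, g) = P (l%:E, 0) + g * (P (l%:E, 1) - P (l%:E, 0)).
  have t0 := decision_rule_test _ (lower_test_rule (l%:E, 0) i0).
  have t1 := decision_rule_test _ (lower_test_rule (l%:E, 1) i1).
  have L0 := L1_test _ _ _ t0 f_L1; have L1' := L1_test _ _ _ t1 f_L1.
  rewrite /P /pairing -RintegralB// -RintegralZl//; last exact: L1B.
  rewrite -RintegralD//; last by apply: L1Z; exact: L1B.
  apply: eq_Rintegral => y _; rewrite /lower_test/=.
  by case: ifP => _; [ring|case: ifP => _; ring].
have [FG|FG] := eqVneq (P (l%:E, 1)) (P (l%:E, 0)).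
  by exists (l%:E, 0); split => //; rewrite -/(P _); lra.
have FG0 : 0 < P (l%:E, 1) - P (l%:E, 0).
  by rewrite subr_gt0 lt_neqAle eq_sym FG (le_trans Gl).
exists (l%:E, (s - P (l%:E, 0)) / (P (l%:E, 1) - P (l%:E, 0))); split => //=.
  by rewrite divr_ge0 ?ler_pdivrMr ?mul1r; lra.
by rewrite -/(P _) mix mulfVK ?gt_eqF//; lra.
Unshelve. all: by end_near.
Qed.

End lower_tests.

(** * Two-tailed tests *)

Section two_tailed_tests.
Context {d : measure_display} {Y : measurableType d} {R : realType}.
Variables (mu : {measure set Y -> \bar R}) (T f : Y -> R).
Hypotheses (mT : measurable_fun setT T) (f_ge0 : forall y, 0 <= f y).
Hypotheses (f_L1 : L1 mu f) (f_prob : pairing mu (fun=> 1) f = 1).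
Implicit Types (s v t : R) (delta : Y -> R).

(** Clamping the mass makes the family of one-sided tests continuous on the whole
    line, so that no boundary has to be treated separately. *)
Definition clamp01 s : R := Num.max 0 (Num.min s 1).

Lemma clamp01_itv s : 0 <= clamp01 s <= 1.
Proof. by rewrite /clamp01 le_max lexx/= ge_max ler01 ge_min lexx orbT. Qed.

Lemma clamp01_id s : 0 <= s <= 1 -> clamp01 s = s.
Proof. by case/andP => s0 s1; rewrite /clamp01 min_l// max_r. Qed.

Lemma clamp01_lip s v : `|clamp01 s - clamp01 v| <= `|s - v|.
Proof.
have h1 := ler_norm (s - v); have := ler_norm (v - s).
rewrite distrC => h2; have h3 := normr_ge0 (s - v).
rewrite /clamp01; case: (leP s 1) => s1; case: (leP v 1) => v1;
  rewrite ?(max_r ler01); case: (leP 0 s) => s0; case: (leP 0 v) => v0;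
  rewrite ler_norml; lra.
Qed.

Definition quantile s : \bar R * R := xget (-oo%E, 0)
  [set p | 0 <= p.2 <= 1 /\ pairing mu (lower_test T p) f = clamp01 s].

Lemma quantileP s : 0 <= (quantile s).2 <= 1 /\
  pairing mu (lower_test T (quantile s)) f = clamp01 s.
Proof.
rewrite /quantile; case: xgetP => //= nex.
have [p hp] := quantile_exists mu T f mT f_ge0 f_L1 f_prob _ (clamp01_itv s).
by have := nex p.
Qed.

Definition lower s := lower_test T (quantile s).

Lemma lower_rule s : decision_rule (lower s).
Proof. by apply: lower_test_rule => //; case: (quantileP s). Qed.

Lemma lower_mass s : 0 <= s <= 1 -> pairing mu (lower s) f = s.
Proof. by move=> s01; have [_ ->] := quantileP s; exact: clamp01_id. Qed.

Let lower_t s : test_function (lower s).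
Proof. exact/decision_rule_test/lower_rule. Qed.

Let one_t : test_function (fun _ : Y => 1 : R).
Proof. by split=> [|y]; [exact: measurable_cst|rewrite normr1]. Qed.

(** The two tests are comparable, and the order of their masses excludes the wrong
    direction. *)
Lemma lower_mono s v : 0 <= s -> s < v -> v <= 1 ->
  ((quantile s).1 <= (quantile v).1)%E /\ forall y, lower s y <= lower v y.
Proof.
move=> s0 sv v1; have [q1 _] := quantileP s; have [q2 _] := quantileP v.
have [//|[_ le]] := lower_test_total T _ _ q1 q2.
exfalso; suff : pairing mu (lower v) f <= pairing mu (lower s) f.
  by rewrite !lower_mass; lra.
rewrite -subr_ge0 -pairingBl//; apply: pairing_ge0 => y.
by apply: mulr_ge0 => //; rewrite subr_ge0; exact: le.
Qed.

(** Since one-sided tests are comparable, the difference of two of them is, up to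
    sign, a rule of mass at most the distance of the parameters; uniform
    integrability bounds its pairing with [w * f]. *)
Lemma lower_continuous (w : Y -> R) : measurable_fun setT w ->
  L1 mu (fun y => w y * f y) ->
  continuous (fun s => pairing mu (lower s) (fun y => w y * f y)).
Proof.
move=> mw Lw s; apply/cvgrPdist_lt => e e0.
have e20 : 0 < e / 2 by lra.
have [M M0 hM] := pairing_uniformly_integrable mu w f (e / 2) e20 f_ge0 f_L1 mw
  Lw.
(* [M] is chosen for the error [e / 2], which leaves [M * `|s - v| < e / 2]. *)
suff key v : `|pairing mu (lower s) (fun y => w y * f y) -
    pairing mu (lower v) (fun y => w y * f y)| <= M * `|s - v| + e / 2.
  have d0 : 0 < e / 2 / (M + 1) by apply: divr_gt0 => //; lra.
  near=> v; apply: (le_lt_trans (key v)).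
  have : `|s - v| < e / 2 / (M + 1).
    by near: v; exact: (nbhsx_ballx s _ d0).
  rewrite ltr_pdivlMr; last lra.
  by have := normr_ge0 (s - v); nra.
wlog le : s v / forall y, lower v y <= lower s y.
  move=> W; have [q1 _] := quantileP s; have [q2 _] := quantileP v.
  have [[_ le]|[_ le]] := lower_test_total T _ _ q1 q2; last exact: W.
  by rewrite distrC (distrC s); exact: W.
rewrite -pairingBl//.
have rD : decision_rule (fun y => lower s y - lower v y).
  split; first by have [] := decision_ruleB _ _ (lower_rule s) (lower_rule v).
  move=> y; rewrite subr_ge0 le/=.
  by have [_ /(_ y)] := lower_rule s; have [_ /(_ y)] := lower_rule v; lra.
apply: (le_trans (hM _ rD)); rewrite lerD2r ler_wpM2l// pairingBl//.
have [_ ->] := quantileP s; have [_ ->] := quantileP v.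
exact: le_trans (ler_norm _) (clamp01_lip _ _).
Unshelve. all: by end_near.
Qed.

(** The sum of the lower test of mass [s] and of the upper test of mass [1 - v]. *)
Definition two_tail s v y := 1 - (lower v y - lower s y).

Lemma two_tail_rule s v : 0 <= s -> s <= v -> v <= 1 ->
  decision_rule (two_tail s v).
Proof.
move=> s0 sv v1; split.
  by apply: measurable_funB => //; apply: measurable_funB;
    [exact: (lower_rule v).1|exact: (lower_rule s).1].
move=> y; have := (lower_rule s).2 y; have := (lower_rule v).2 y.
rewrite /two_tail; move: sv; rewrite le_eqVlt => /predU1P[->|sv].
  by rewrite subrr subr0 ler01 lexx.
have [_ /(_ y)] := lower_mono _ _ s0 sv v1; lra.
Qed.

Lemma pairing_two_tail s v g : L1 mu g -> pairing mu (two_tail s v) g =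
  pairing mu (fun=> 1) g - (pairing mu (lower v) g - pairing mu (lower s) g).
Proof.
by move=> Lg; rewrite /two_tail -!pairingBl//;
  exact: decision_ruleB (lower_rule _) (lower_rule _).
Qed.

Lemma lower_test_oo (g : R) :
  pairing mu (lower_test T (-oo%E, g)) f = 0 /\
  pairing mu (lower_test T (+oo%E, g)) f = 1.
Proof.
split.
  rewrite /pairing; under eq_Rintegral => y _.
    rewrite /lower_test/= mul0r; over.
  by rewrite Rintegral_cst// mul0r.
by rewrite -[RHS]f_prob; apply: eq_Rintegral => y _; rewrite /lower_test/= ltry.
Qed.

(** With an infinite threshold the test would be constant, of mass 0 or 1. *)
Lemma quantile_ltey s : s < 1 -> ((quantile s).1 < +oo)%E.
Proof.
move=> s1; rewrite ltey; apply/eqP => qE; have [_] := quantileP s.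
rewrite (surjective_pairing (quantile s)) qE (lower_test_oo _).2 /clamp01.
by rewrite min_l ?ltW//; case: (leP 0 s); lra.
Qed.

Lemma quantile_gtNy s : 0 < s -> (-oo < (quantile s).1)%E.
Proof.
move=> s0; rewrite ltNye; apply/eqP => qE; have [_] := quantileP s.
rewrite (surjective_pairing (quantile s)) qE (lower_test_oo _).1 /clamp01.
by rewrite max_r ?le_min ?(ltW s0) ?ler01//; case: (leP s 1); lra.
Qed.

(** Nothing is claimed at the two thresholds, where the test is randomized. *)
Lemma two_tailE s v y (l := (quantile s).1) (u := (quantile v).1) :
  (l <= u)%E ->
  (((u < (T y)%:E)%E \/ ((T y)%:E < l)%E) -> two_tail s v y = 1) /\
  ((l < (T y)%:E)%E /\ ((T y)%:E < u)%E -> two_tail s v y = 0).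
Proof.
rewrite /two_tail /lower /lower_test -/l -/u => lu; split.
  case=> h.
    rewrite !ltNge (ltW h) (ltW (le_lt_trans lu h))/= !gt_eqF ?(le_lt_trans lu
      h)//.
    by rewrite !subr0.
  by rewrite h (lt_le_trans h lu) subrr subr0.
by move=> [h1 h2]; rewrite h2 ltNge (ltW h1)/= gt_eqF// subr0 subrr.
Qed.

End two_tailed_tests.

(** * Comparison of a rule with a two-tailed test *)

Section essential_completeness.
Context {d : measure_display} {Y : measurableType d} {R : realType}.
Variables (mu : {measure set Y -> \bar R}) (T f : Y -> R).
Hypotheses (mT : measurable_fun setT T) (f_ge0 : forall y, 0 <= f y).
Hypotheses (f_L1 : L1 mu f) (f_prob : pairing mu (fun=> 1) f = 1).
Variable x : R -> R.
Hypotheses (x_incr : forall s t, s < t -> x s < x t).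
Hypotheses (mx : measurable_fun setT (fun y => x (T y))).
Hypotheses (x_L1 : L1 mu (fun y => x (T y) * f y)).
Implicit Types (s v t : R) (delta : Y -> R).

Local Notation lowr := (lower mu T f).
Local Notation tail2 := (two_tail mu T f).
Let lowr_rule s : decision_rule (lowr s). Proof. exact: lower_rule. Qed.
Let lowr_t s : test_function (lowr s).
Proof. exact/decision_rule_test/lowr_rule. Qed.
Let one_t : test_function (fun _ : Y => 1 : R).
Proof. by split=> [|y]; [exact: measurable_cst|rewrite normr1]. Qed.

Let pairing_shift phi (w : R -> R) (c : R) : test_function phi ->
  L1 mu (fun y => w (T y) * f y) ->
  pairing mu phi (fun y => (w (T y) - w c) * f y) =
  pairing mu phi (fun y => w (T y) * f y) - w c * pairing mu phi f.
Proof.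
move=> tphi Lw; rewrite -mulNr -pairingZr// -pairingDr//; last exact: L1Z.
by congr pairing; apply/funext => y; ring.
Qed.

Let L1_shift (w : R -> R) (c : R) : L1 mu (fun y => w (T y) * f y) ->
  L1 mu (fun y => (w (T y) - w c) * f y).
Proof.
move=> Lw; rewrite (_ : (fun _ => _) =
  (fun y => w (T y) * f y + (- w c) * f y)); first by apply: L1D => //;
    exact: L1Z.
by apply/funext => y; ring.
Qed.

(** Neyman-Pearson: [delta - lower s] has the sign of [T - c], where [c] is the
    threshold, hence that of [x (T) - x c]. *)
Lemma lower_minimizes s delta : 0 < s < 1 -> decision_rule delta ->
  pairing mu delta f = s ->
  pairing mu (lowr s) (fun y => x (T y) * f y) <=
  pairing mu delta (fun y => x (T y) * f y).
Proof.
move=> /andP[s0 s1] rd ds; have td := decision_rule_test _ rd.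
have := quantile_ltey mu T f mT f_ge0 f_L1 f_prob _ s1.
have := quantile_gtNy mu T f mT f_ge0 f_L1 f_prob _ s0.
case E : (quantile mu T f s).1 => [c| |]// _ _.
have eta_t := decision_ruleB _ _ rd (lowr_rule s).
rewrite -subr_ge0 -pairingBl//.
have := pairing_shift _ x c eta_t x_L1.
rewrite (pairingBl mu delta (lowr s) f)// ds lower_mass ?subrr ?mulr0 ?subr0//;
  last by rewrite !ltW.
move=> <-; apply: pairing_ge0 => y; rewrite mulrA mulr_ge0//.
rewrite /lower /lower_test E lte_fin eqe; have /andP[d0 d1] := rd.2 y.
case: ltgtP => [h|h|->]; last by rewrite subrr mulr0.
- by have := x_incr _ _ h; nra.
- by have := x_incr _ _ h; nra.
Qed.

(** Write [m] for the mass of [delta]. The parameters with the right mass are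
    [(s, s + (1 - m))]; at both ends [s = 0] and [s = m] the test is one-sided,
    and there [lower_minimizes] bounds the integral of [x * f]. *)
Lemma two_tail_matches delta : decision_rule delta ->
  0 < pairing mu delta f < 1 -> exists s v, [/\ 0 <= s, s < v, v <= 1,
    pairing mu (tail2 s v) f = pairing mu delta f &
    pairing mu (tail2 s v) (fun y => x (T y) * f y) =
    pairing mu delta (fun y => x (T y) * f y)].
Proof.
move=> rd; set m := pairing mu delta f => /andP[m0 m1].
have td := decision_rule_test _ rd.
pose xf y := x (T y) * f y.
(* Equal masses fix [v - s = 1 - m]; [N] is the integral of the accepted part. *)
pose N s := pairing mu (lowr (s + (1 - m))) xf - pairing mu (lowr s) xf.
have low0 : pairing mu (lowr 0) xf = 0.
  apply: (pairing_null mu (lowr 0) (lowr 0) f xf) => //.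
  - by move=> y; rewrite mulr_ge0//; case/andP: ((lowr_rule 0).2 y).
  - by rewrite lower_mass// lexx ler01.
  - by move=> y; rewrite /xf mulrCA => ->; rewrite mulr0.
have low1 : pairing mu (lowr 1) xf = pairing mu (fun=> 1) xf.
  apply/esym/eqP; rewrite -subr_eq0 -pairingBl//; apply/eqP.
  have rone : decision_rule (fun _ : Y => 1 : R).
    by split=> [|y]; [exact: measurable_cst|rewrite ler01 lexx].
  have tt := decision_ruleB _ _ rone (lowr_rule 1).
  apply: (pairing_null mu (fun y => 1 - lowr 1 y) (fun y => 1 - lowr 1 y) f xf)
    => //.
  - by move=> y; rewrite mulr_ge0// subr_ge0; case/andP: ((lowr_rule 1).2 y).
  - by rewrite pairingBl// f_prob lower_mass ?subrr// ler01 lexx.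
  - by move=> y; rewrite /xf mulrCA => ->; rewrite mulr0.
have rcompl : decision_rule (fun y => 1 - delta y).
  split; first by apply: measurable_funB => //; case: rd.
  by move=> y; have /andP[? ?] := rd.2 y; rewrite subr_ge0 gerBl; apply/andP.
have compl g : L1 mu g -> pairing mu (fun y => 1 - delta y) g =
    pairing mu (fun=> 1) g - pairing mu delta g.
  by move=> Lg; rewrite pairingBl.
have cN : continuous N.
  have cl := lower_continuous mu T f mT f_ge0 f_L1 f_prob _ mx x_L1.
  move=> s; apply: cvgB; last exact: cl.
  apply: (@continuous_comp _ _ _ (fun s => s + (1 - m))
    (fun s => pairing mu (lowr s) xf)); last exact: cl.
  by apply: cvgD; [exact: cvg_id|exact: cvg_cst].
have := @IVT _ N 0 m (pairing mu (fun=> 1) xf - pairing mu delta xf) (ltW m0) _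
  _.
case.
- exact: continuous_subspaceT.
- have h0 : N 0 <= pairing mu (fun=> 1) xf - pairing mu delta xf.
    rewrite /N low0 subr0 add0r -compl//; apply: lower_minimizes => //.
      by rewrite subr_gt0 m1 gtrBl m0.
    by rewrite compl// f_prob.
  have h1 : pairing mu (fun=> 1) xf - pairing mu delta xf <= N m.
    rewrite /N subrKC low1 lerB// lower_minimizes//.
    by rewrite m0.
  move: (N 0) (N m) (_ - _) h0 h1 => N0 Nm r h0 h1.
  by rewrite ge_min h0 le_max h1 orbT.
move=> s; rewrite in_itv/= => /andP[s0 sm] Ns.
have s1 : s <= 1 by exact: le_trans sm (ltW m1).
have sw0 : 0 <= s + (1 - m) by rewrite addr_ge0// subr_ge0 ltW.
have sw1 : s + (1 - m) <= 1 by rewrite addrCA gerDl subr_le0.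
exists s, (s + (1 - m)); split => //; first by rewrite ltrDl subr_gt0.
- rewrite pairing_two_tail// f_prob.
  have -> : pairing mu (lower mu T f s) f = s.
    by apply: lower_mass => //; apply/andP.
  have -> : pairing mu (lower mu T f (s + (1 - m))) f = s + (1 - m).
    by apply: lower_mass => //; apply/andP.
  by rewrite addrAC subrr add0r opprB addrC subrK.
- rewrite pairing_two_tail//;
  by rewrite -[RHS](subKr (pairing mu (fun=> 1) xf)) -Ns.
Qed.

(** With a single sign change the two constraints already force [eta] to vanish
    almost everywhere off [T = c]. *)
Lemma one_sided_rigidity (z : R -> R) (c : R) eta : test_function eta ->
  (forall y, 0 <= eta y * (x (T y) - x c)) \/
  (forall y, eta y * (x (T y) - x c) <= 0) ->
  L1 mu (fun y => z (T y) * f y) ->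
  pairing mu eta f = 0 -> pairing mu eta (fun y => x (T y) * f y) = 0 ->
  pairing mu eta (fun y => z (T y) * f y) = 0.
Proof.
move=> teta sgn Lz e0 ex0.
wlog pos : eta teta {sgn} e0 ex0 / forall y, 0 <= eta y * (x (T y) - x c).
  move=> W; case: sgn => [|neg]; first exact: W.
  have tN : test_function (fun y => -1 * eta y).
    case: teta => m b; split; first by apply: measurable_funM.
    by move=> y; rewrite mulN1r normrN.
  have := W (fun y => -1 * eta y) tN.
  rewrite !pairingZl// e0 ex0 mulr0 => /(_ erefl erefl) h.
  suff : -1 * pairing mu eta (fun y => z (T y) * f y) = 0 by lra.
  by apply: h => y; have := neg y; lra.
have := pairing_shift _ z c teta Lz; rewrite e0 mulr0 subr0 => <-.
apply: (pairing_null mu eta eta (fun y => (x (T y) - x c) * f y)) => //.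
- exact: L1_shift.
- exact: L1_shift.
- by move=> y; rewrite mulrA mulr_ge0.
- by rewrite pairing_shift// e0 ex0 mulr0 subr0.
move=> y; rewrite !mulrA => /eqP; rewrite !mulf_eq0 -orbA.
case/or3P => [/eqP->|h|/eqP->]; rewrite ?mul0r ?mulr0//.
have -> : T y = c.
  have [hh|hh|->//] := ltgtP (T y) c;
    by have := x_incr _ _ hh; move/eqP: h; lra.
by rewrite subrr mulr0 mul0r.
Qed.

(** If both thresholds are finite, the difference of the two rules has the sign of
    [z] minus its chord. With an infinite threshold there is only one sign
    change, no chord is available, and rigidity shows that the two integrals are
    equal. *)
Lemma two_tail_dominates (z : R -> R) s v delta :
  (forall l u, l <= u -> exists k0 k1,
    (forall t, l <= t <= u -> z t <= k0 + k1 * x t) /\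
    (forall t, t <= l \/ u <= t -> k0 + k1 * x t <= z t)) ->
  L1 mu (fun y => z (T y) * f y) ->
  0 <= s -> s < v -> v <= 1 -> decision_rule delta ->
  pairing mu (tail2 s v) f = pairing mu delta f ->
  pairing mu (tail2 s v) (fun y => x (T y) * f y) =
    pairing mu delta (fun y => x (T y) * f y) ->
  pairing mu delta (fun y => z (T y) * f y) <=
    pairing mu (tail2 s v) (fun y => z (T y) * f y).
Proof.
move=> sep Lz s0 sv v1 rd ef ex; have td := decision_rule_test _ rd.
have r2 := two_tail_rule mu T f mT f_ge0 f_L1 f_prob _ _ s0 (ltW sv) v1.
have t2 := decision_rule_test _ r2.
have [lu _] := lower_mono mu T f mT f_ge0 f_L1 f_prob _ _ s0 sv v1.
have ly := quantile_ltey mu T f mT f_ge0 f_L1 f_prob _ (lt_le_trans sv v1).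
have uy := quantile_gtNy mu T f mT f_ge0 f_L1 f_prob _ (le_lt_trans s0 sv).
have shape y := two_tailE mu T f _ _ y lu.
have teta := decision_ruleB _ _ r2 rd.
rewrite -subr_ge0 -pairingBl//.
have e0 : pairing mu (fun y => tail2 s v y - delta y) f = 0.
  by rewrite pairingBl// ef subrr.
have ex0 : pairing mu (fun y => tail2 s v y - delta y) (fun y => x (T y) * f y)
  = 0.
  by rewrite pairingBl// ex subrr.
move: shape lu ly uy.
case: (quantile mu T f s).1 => [l| |]; case: (quantile mu T f v).1 => [u| |]//;
  rewrite ?lee_fin => shape lu _ _.
- have [k0 [k1 [kin kout]]] := sep _ _ lu.
  have Lk : L1 mu (fun y => - k0 * f y + - k1 * (x (T y) * f y)).
    by apply: L1D; exact: L1Z.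
  have <- : pairing mu (fun y => tail2 s v y - delta y)
     (fun y => z (T y) * f y + (- k0 * f y + - k1 * (x (T y) * f y))) =
     pairing mu (fun y => tail2 s v y - delta y) (fun y => z (T y) * f y).
    rewrite pairingDr// pairingDr//; [|exact: L1Z..].
    by rewrite !pairingZr// e0 ex0 !mulr0 !addr0.
  apply: pairing_ge0 => y.
  have -> : z (T y) * f y + (- k0 * f y + - k1 * (x (T y) * f y)) =
    (z (T y) - (k0 + k1 * x (T y))) * f y by ring.
  rewrite mulrA mulr_ge0//; have [out inn] := shape y.
  have /andP[d0 d1] := rd.2 y; move: out inn; rewrite !lte_fin => out inn.
  have := kin (T y); have := kout (T y).
  set K := k0 + _; move: (z (T y)) K (delta y) d0 d1 => zT K D d0 d1 ko ki.
  case: (ltP (T y) l) => [Tl|lT].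
    by rewrite out; [have := ko (or_introl (ltW Tl)); nra|right].
  case: (ltP u (T y)) => [uT|Tu].
    by rewrite out; [have := ko (or_intror (ltW uT)); nra|left].
  have := ki; rewrite lT Tu => /(_ isT).
  move: lT; rewrite le_eqVlt => /predU1P[lT|lT].
    have := ko (or_introl _); rewrite lT => /(_ (lexx _)) h1 h2.
    by rewrite (_ : zT = K) ?subrr ?mulr0//; apply/eqP; rewrite eq_le h1 h2.
  move: Tu; rewrite le_eqVlt => /predU1P[Tu|Tu].
    have := ko (or_intror _); rewrite Tu => /(_ (lexx _)) h1 h2.
    by rewrite (_ : zT = K) ?subrr ?mulr0//; apply/eqP; rewrite eq_le h1 h2.
  by rewrite inn//; nra.
- rewrite (one_sided_rigidity z l)//; right => y; have [out inn] := shape y.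
  have /andP[d0 d1] := rd.2 y; move: out inn; rewrite !lte_fin ltry => out inn.
  have [h|h|->] := ltgtP (T y) l; last by rewrite subrr mulr0.
    rewrite out; last by right. have := x_incr _ _ h; nra.
  rewrite inn//; have := x_incr _ _ h; nra.
- rewrite (one_sided_rigidity z u)//; left => y; have [out inn] := shape y.
  have /andP[d0 d1] := rd.2 y; move: out inn; rewrite !lte_fin ltNyr => out inn.
  have [h|h|->] := ltgtP (T y) u; last by rewrite subrr mulr0.
    rewrite inn//. have := x_incr _ _ h; nra.
  rewrite out; last by left. have := x_incr _ _ h; nra.
- have tail0 y : tail2 s v y = 0.
    by have [_ ->] := shape y; rewrite ?ltNyr ?ltry.
  have d0 : pairing mu delta f = 0.
    rewrite -ef /pairing; under eq_Rintegral => y _ do rewrite tail0 mul0r.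
    by rewrite Rintegral_cst// mul0r.
  rewrite (pairing_null mu delta (fun y => tail2 s v y - delta y) f)//.
    by move=> y; rewrite mulr_ge0//; case/andP: (rd.2 y).
  move=> y; rewrite tail0 sub0r mulNr mulrCA => ->.
  by rewrite mulr0 oppr0.
Qed.

(** The proof compares the test with the constant rule [beta]; only the signs of the
    integrals against [f] and [x * f] are left of the equality constraints of
    [two_tail_dominates], which is why [k0] and [k1] have to be nonnegative. *)
Lemma two_tail_quasiconvex (z : R -> R) s v (beta : R) :
  (forall l u : \bar R, (l <= u)%E -> (l < +oo)%E -> (-oo < u)%E ->
    exists k0 k1, [/\ 0 <= k0, 0 <= k1,
      (forall t, (l <= t%:E)%E /\ (t%:E <= u)%E -> k0 + k1 * x t <= z t) &
      (forall t, (t%:E <= l)%E \/ (u <= t%:E)%E -> z t <= k0 + k1 * x t)]) ->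
  L1 mu (fun y => z (T y) * f y) ->
  0 <= s -> s < v -> v <= 1 -> 0 <= beta <= 1 ->
  pairing mu (fun y => tail2 s v y - beta) f <= 0 ->
  pairing mu (fun y => tail2 s v y - beta) (fun y => x (T y) * f y) <= 0 ->
  pairing mu (fun y => tail2 s v y - beta) (fun y => z (T y) * f y) <= 0.
Proof.
move=> sep Lz s0 sv v1 /andP[b0 b1] e0 ex0.
have r2 := two_tail_rule mu T f mT f_ge0 f_L1 f_prob _ _ s0 (ltW sv) v1.
have [lu _] := lower_mono mu T f mT f_ge0 f_L1 f_prob _ _ s0 sv v1.
have ly := quantile_ltey mu T f mT f_ge0 f_L1 f_prob _ (lt_le_trans sv v1).
have uy := quantile_gtNy mu T f mT f_ge0 f_L1 f_prob _ (le_lt_trans s0 sv).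
have shape y := two_tailE mu T f _ _ y lu.
have rb : decision_rule (fun _ : Y => beta).
  by split=> [|y]; [exact: measurable_cst|rewrite b0 b1].
have teta := decision_ruleB _ _ r2 rb.
have [k0 [k1 [k00 k10 kin kout]]] := sep _ _ lu ly uy.
have Lk : L1 mu (fun y => k0 * f y + k1 * (x (T y) * f y)).
  by apply: L1D; exact: L1Z.
apply: (@le_trans _ _ (pairing mu (fun y => tail2 s v y - beta)
   (fun y => k0 * f y + k1 * (x (T y) * f y)))); last first.
  by rewrite pairingDr//; [rewrite !pairingZr//; nra|exact: L1Z..].
apply: le_Rintegral => //; [exact: L1_test|exact: L1_test|] => y _.
have -> : k0 * f y + k1 * (x (T y) * f y) = (k0 + k1 * x (T y)) * f y by ring.
rewrite !mulrA ler_wpM2r//; have [out inn] := shape y.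
move: (kin (T y)) (kout (T y)) out inn.
set l := (quantile mu T f s).1; set u := (quantile mu T f v).1 => ki ko out inn.
case: (ltP (T y)%:E l) => [Tl|lT].
  rewrite out; last by right. have := ko (or_introl (ltW Tl)); nra.
case: (ltP u (T y)%:E) => [uT|Tu].
  rewrite out; last by left. have := ko (or_intror (ltW uT)); nra.
have h1 := ki (conj lT Tu).
have tie : z (T y) <= k0 + k1 * x (T y) ->
    (tail2 s v y - beta) * z (T y) <=
    (tail2 s v y - beta) * (k0 + k1 * x (T y)).
  move=> h2; rewrite (_ : z (T y) = k0 + k1 * x (T y))//.
  by apply/eqP; rewrite eq_le h1 h2.
move: lT; rewrite le_eqVlt => /predU1P[lT|lT].
  by apply/tie/ko; left; rewrite lT.
move: Tu; rewrite le_eqVlt => /predU1P[Tu|Tu].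
  by apply/tie/ko; right; rewrite Tu.
by rewrite inn//; nra.
Qed.

End essential_completeness.

(** * Powers in the exponential family *)

(** Brings dominated convergence, which is about sequences, to bear on continuity
    in one or two real parameters. *)
Lemma within_continuous_seq {R : realType} {X : pseudoMetricType R} (A : set X)
    (F : X -> R) :
  (forall (u : nat -> X) p, (forall n, A (u n)) -> A p ->
    u n @[n --> \oo] --> p -> F (u n) @[n --> \oo] --> F p) ->
  {within A, continuous F}.
Proof.
move=> H; apply/subspace_continuousP => p Ap; apply/cvgrPdist_lt => e e0.
apply: contrapT => nex.
have bad (n : nat) : exists z, [/\ A z, ball p n.+1%:R^-1 z & e <= `|F p - F
  z|].
  apply: contrapT => nz; apply: nex; rewrite /within /=.
  have n0 : 0 < n.+1%:R^-1 :> R by rewrite invr_gt0.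
  apply: filterS (nbhsx_ballx p _ n0) => z bz Az.
  by rewrite ltNge; apply/negP => h; apply: nz; exists z.
have {bad}[u hu] := choice bad.
have up : u n @[n --> \oo] --> p.
  apply/cvg_ballP => r r0; near=> n; have [_ b _] := hu n.
  apply: le_ball b; apply/ltW.
  by near: n; exact: (near_infty_natSinv_lt (PosNum r0)).
have Au n : A (u n) by have [] := hu n.
have /cvgrPdist_lt/(_ _ e0)[n _ /(_ n (leqnn n))/=] := H u p Au Ap up.
by have [_ _ h] := hu n; rewrite ltNge h.
Unshelve. all: by end_near.
Qed.

Section exponential_family.
Context {d : measure_display} {Y : measurableType d} {R : realType}.
Variables (mu : {measure set Y -> \bar R}) (h T : Y -> R) (K : R).
Hypotheses (h_meas : measurable_fun setT h) (h_ge0 : forall y, 0 <= h y).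
Hypothesis T_meas : measurable_fun setT T.
Hypothesis Theta_D : `[- K, K] `<=` natural_domain mu h T.
Hypothesis f_density : forall theta : R, - K <= theta <= K ->
  (\int[mu]_y (density mu h T theta y)%:E)%E = 1%E.
Implicit Types (theta a b s v : R) (delta : Y -> R).

Let P theta delta := power mu h T theta delta.
Let inK theta := - K <= theta <= K.

Lemma measurable_expR_scale (c : R) : measurable_fun setT (fun y => expR (c * T
  y)).
Proof.
by apply: measurableT_comp => //; apply: measurable_funM => //.
Qed.

Lemma kernel_L1 theta : inK theta -> L1 mu (fun y => h y * expR (theta * T y)).
Proof.
move=> th; have mf : measurable_fun setT (fun y => h y * expR (theta * T y)).
  by apply: measurable_funM => //; exact: measurable_expR_scale.
apply/integrableP; split; first exact/measurable_EFinP.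
have := Theta_D theta; rewrite /natural_domain/= in_itv/= => /(_ th).
rewrite /partition_function => lt.
by under eq_integral => y _ do rewrite /= ger0_norm ?mulr_ge0 ?expR_ge0//.
Qed.

Lemma densityE theta : density mu h T theta =
  fun y => normalizer mu h T theta * (h y * expR (theta * T y)).
Proof. by apply/funext => y; rewrite /density mulrA. Qed.

Lemma density_L1 theta : inK theta -> L1 mu (density mu h T theta).
Proof. by move=> th; rewrite densityE; apply/L1Z/kernel_L1. Qed.

(** If the normalizer were 0, the density would not have integral 1. *)
Lemma normalizer_gt0 theta : inK theta -> 0 < normalizer mu h T theta.
Proof.
move=> th; rewrite lt0r; apply/andP; split; last first.
  rewrite /normalizer invr_ge0 fine_ge0//; apply: integral_ge0 => y _.
  by rewrite lee_fin mulr_ge0 ?expR_ge0.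
apply/eqP => n0; have := f_density _ th; rewrite densityE n0.
under eq_integral => y _ do rewrite mul0r.
by rewrite integral0 => /esym/eqP; rewrite onee_eq0.
Qed.

Lemma density_ge0 theta : inK theta -> forall y, 0 <= density mu h T theta y.
Proof.
move=> th y; rewrite densityE; apply: mulr_ge0; first exact/ltW/normalizer_gt0.
by rewrite mulr_ge0 ?expR_ge0.
Qed.

Lemma powerE theta delta :
  power mu h T theta delta = pairing mu delta (density mu h T theta).
Proof. by []. Qed.

Lemma power1 theta : inK theta -> pairing mu (fun=> 1) (density mu h T theta) =
  1.
Proof.
move=> th; rewrite /pairing /Rintegral.
by under eq_integral => y _ do rewrite mul1r; rewrite f_density.
Qed.

(** All the densities are obtained from the one at [a] by exponential tilting; in
    particular they are mutually absolutely continuous. *)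
Lemma density_tilt theta a : inK a ->
  density mu h T theta = fun y =>
  normalizer mu h T theta / normalizer mu h T a *
    (expR ((theta - a) * T y) * density mu h T a y).
Proof.
move=> aK; apply/funext => y; rewrite !densityE.
have n0 := normalizer_gt0 _ aK.
have -> : expR (theta * T y) = expR ((theta - a) * T y) * expR (a * T y).
  by rewrite -expRD -mulrDl subrK.
by field; rewrite gt_eqF.
Qed.

Lemma tilt_L1 theta a : inK a -> inK theta ->
  L1 mu (fun y => expR ((theta - a) * T y) * density mu h T a y).
Proof.
move=> aK th; have n1 := normalizer_gt0 _ aK; have n2 := normalizer_gt0 _ th.
have := L1Z mu (normalizer mu h T a / normalizer mu h T theta) _ (density_L1 _
  th).
rewrite (density_tilt theta _ aK) (_ : (fun _ => _) =
  (fun y => expR ((theta - a) * T y) * density mu h T a y))//.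
by apply/funext => y; field; rewrite !gt_eqF.
Qed.

Lemma power_tilt theta a delta : inK a -> inK theta -> test_function delta ->
  P theta delta = normalizer mu h T theta / normalizer mu h T a *
    pairing mu delta (fun y => expR ((theta - a) * T y) * density mu h T a y).
Proof.
move=> aK th td; rewrite /P powerE (density_tilt theta _ aK) pairingZr//.
exact: tilt_L1.
Qed.

Lemma power_null theta a delta : inK a -> inK theta -> decision_rule delta ->
  P a delta = 0 -> P theta delta = 0.
Proof.
move=> aK th rd e0; have td := decision_rule_test _ rd.
apply: (pairing_null mu delta delta (density mu h T a)) => //.
- exact: density_L1.
- exact: density_L1.
- by move=> y; rewrite mulr_ge0 ?density_ge0//; case/andP: (rd.2 y).
by move=> y; rewrite (density_tilt theta _ aK) !(mulrCA (delta y)) => ->;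
  rewrite !mulr0.
Qed.

Lemma power_cst theta (c : R) : inK theta -> P theta (fun=> c) = c.
Proof.
move=> th; rewrite /P powerE -[RHS]mulr1 -(power1 _ th) -[in RHS]pairingZl.
- by congr pairing; apply/funext => y; rewrite mulr1.
- by split=> [|y]; [exact: measurable_cst|rewrite normr1].
- exact: density_L1.
Qed.

Lemma power_itv theta delta : inK theta -> decision_rule delta ->
  0 <= P theta delta <= 1.
Proof.
move=> th rd; apply/andP; split.
  by apply: pairing_ge0 => y; rewrite mulr_ge0 ?density_ge0//;
    case/andP: (rd.2 y).
rewrite -(power_cst theta 1 th); apply: le_Rintegral => //.
- by apply: L1_test; [exact: decision_rule_test|exact: density_L1].
- apply: L1_test; last exact: density_L1.
  by split=> [|y]; [exact: measurable_cst|rewrite normr1].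
- by move=> y _; rewrite ler_wpM2r ?density_ge0//; case/andP: (rd.2 y).
Qed.

(** The power is a quotient of two integrals against [h * expR (theta * T)], and on
    [[- K, K]] these integrands are dominated by [h * expR (K * `|T|)]. *)
Lemma power_continuous delta : decision_rule delta ->
  {within `[- K, K], continuous (fun theta => P theta delta)}.
Proof.
move=> rd.
pose g y := h y * expR (K * `|T y|).
have mT1 : measurable_fun setT (fun y => `|T y|) by exact: measurableT_comp.
have Lg : 0 <= K -> L1 mu g.
  move=> K0; apply: (@L1_le _ _ _ mu _
    (fun y => h y * expR (K * T y) + h y * expR (- K * T y))).
  - apply: measurable_funM => //; apply: measurableT_comp => //.
    exact: measurable_funM.
  - move=> y; rewrite ger0_norm ?mulr_ge0 ?expR_ge0// -mulrDr ler_wpM2l// mulNr.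
    case: (leP 0 (T y)) => Ty; first by rewrite ger0_norm// lerDl expR_ge0.
    by rewrite ltr0_norm// mulrN lerDr expR_ge0.
  - by apply: L1D; apply: kernel_L1; rewrite /inK lexx; lra.
pose M theta e := pairing mu e (fun y => h y * expR (theta * T y)).
have PM theta : inK theta ->
    M theta (fun=> 1) != 0 /\ P theta delta = M theta delta / M theta (fun=> 1).
  move=> th; have n0 := normalizer_gt0 _ th.
  have PE e : test_function e -> P theta e = normalizer mu h T theta * M theta
    e.
    by move=> te; rewrite /P powerE densityE pairingZr//; exact: kernel_L1.
  have t1 : test_function (fun _ : Y => 1 : R).
    by split=> [|y]; [exact: measurable_cst|rewrite normr1].
  have := PE _ t1; rewrite power_cst// => e1.
  have m0 : M theta (fun=> 1) != 0.
    by apply/eqP => m0; move: e1; rewrite m0 mulr0 => /eqP; rewrite oner_eq0.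
  split=> //; rewrite PE; last exact: decision_rule_test.
  by apply: (mulIf m0); rewrite divfK// mulrAC -e1 mul1r.
have cM (u : nat -> R) p e : (forall n, inK (u n)) -> inK p -> decision_rule e
  ->
    u n @[n --> \oo] --> p -> M (u n) e @[n --> \oo] --> M p e.
  move=> uK pK re up.
  have K0 : 0 <= K by move: pK; rewrite /inK; lra.
  (* Moving the dominating weight to the integrand leaves a factor at most 1. *)
  pose ph theta y := e y * expR (theta * T y - K * `|T y|).
  have phM theta : M theta e = pairing mu (ph theta) g.
    apply: eq_Rintegral => y _; rewrite /ph /g -mulrA; congr (_ * _).
    by rewrite mulrCA -expRD subrK.
  have tph theta : inK theta -> test_function (ph theta).
    move=> /andP[t1 t2]; split.
      apply: measurable_funM; first by case: re.
      apply: measurableT_comp => //; apply: measurable_funB => //;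
        exact: measurable_funM.
    move=> y; have /andP[e0 e1] := re.2 y.
    rewrite ger0_norm ?mulr_ge0 ?expR_ge0// mulr_ile1 ?expR_ge0//.
    rewrite -expR0 ler_expR subr_le0 (le_trans (ler_norm _))// normrM
      ler_wpM2r//.
    by rewrite ler_norml t1.
  rewrite phM; under eq_fun do rewrite phM.
  apply: pairing_cvg => //; [by move=> n; exact: tph|exact: tph|exact: Lg|].
  move=> y; apply: cvgMr; apply: continuous_cvg; first exact: continuous_expR.
  by apply: cvgB; [exact: cvgMl|exact: cvg_cst].
apply: within_continuous_seq => u p.
move=> uA pA up.
have uK n : inK (u n) by have := uA n; rewrite /= in_itv.
have pK : inK p by move: pA; rewrite /= in_itv.
have [m0 ->] := PM _ pK.
under eq_fun => n do rewrite (PM _ (uK n)).2.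
have r1 : decision_rule (fun _ : Y => 1 : R).
  by split=> [|y]; [exact: measurable_cst|rewrite ler01 lexx].
apply: cvgM; first exact: cM.
by apply: cvgV => //; exact: cM.
Qed.

End exponential_family.

(** * Expected utility of a power function *)

Section utility.
Context {R : realType}.
Variables (g : R -> R) (Lambda : probability (measurableTypeR R) R).
Variable D : set R.
Hypothesis mD : measurable (D : set (measurableTypeR R)).
Hypothesis Lambda_D : Lambda D = 1%E.
Hypotheses (mg : measurable_fun (`[0, 1] : set R) g)
  (g_cont : {within `[0, 1], continuous g})
  (g_lt : forall x y, 0 <= x -> x < y -> y <= 1 -> g x < g y).
Implicit Types p q : R -> R.

Definition profile p :=
  measurable_fun (D : set (measurableTypeR R)) p /\
  forall t, D t -> 0 <= p t <= 1.

Definition utility p : R := (\int[Lambda]_(t in D) g (p t))%R.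

Let g_le x y : 0 <= x -> x <= y -> y <= 1 -> g x <= g y.
Proof.
by move=> x0; rewrite le_eqVlt => /predU1P[->//|xy] y1; exact/ltW/g_lt.
Qed.

Let M := `|g 0| + `|g 1|.

Let g_bound x : 0 <= x <= 1 -> `|g x| <= M.
Proof.
move=> /andP[x0 x1]; rewrite /M ler_norml.
have := g_le 0 x (lexx _) x0 x1; have := g_le x 1 x0 x1 (lexx _).
have := ler_norm (g 1); have := ler_norm (- g 0); have := normr_ge0 (g 0).
have := normr_ge0 (g 1); rewrite normrN; lra.
Qed.

Let mgp p : profile p ->
  measurable_fun (D : set (measurableTypeR R)) (g \o p).
Proof.
move=> [mp p01]; apply: (@measurable_comp _ _ _ _ _ _ (`[0%R, 1%R] : set R)) =>
  //.
by move=> _ [t Dt <-]; rewrite /= in_itv/= p01.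
Qed.

Lemma utility_integrable p : profile p -> Lambda.-integrable D (EFin \o (g \o
  p)).
Proof.
move=> hp.
apply: (@le_integrable _ (measurableTypeR R) R Lambda D mD (EFin \o (g \o p))
  (EFin \o cst M)).
  by apply/measurable_EFinP; apply: mgp.
- move=> t Dt /=; rewrite lee_fin (le_trans _ (ler_norm _))// g_bound//.
  exact: hp.2.
- by apply: finite_measure_integrable_cst.
Qed.

Lemma utility_EFin p : profile p ->
  (\int[Lambda]_(t in D) (g (p t))%:E)%E = (utility p)%:E.
Proof.
move=> hp; rewrite /utility /Rintegral fineK//.
exact: (integrable_fin_num mD (utility_integrable _ hp)).
Qed.

Lemma utility_le p q : profile p -> profile q ->
  (forall t, D t -> p t <= q t) -> utility p <= utility q.
Proof.
move=> hp hq pq; apply: le_Rintegral => //; [exact: utility_integrable..|].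
move=> t Dt; have /andP[p0 _] := hp.2 t Dt; have /andP[_ q1] := hq.2 t Dt.
by apply: g_le => //; exact: pq.
Qed.

(** Equal integrals would make the strict inequality fail almost everywhere, but
    [D] has measure 1. *)
Lemma utility_lt p q : profile p -> profile q ->
  (forall t, D t -> p t < q t) -> utility p < utility q.
Proof.
move=> hp hq pq; rewrite lt_neqAle utility_le ?andbT//; last first.
  by move=> t Dt; exact/ltW/pq.
apply/eqP => e.
have gpq t : D t -> g (p t) < g (q t).
  move=> Dt; have /andP[p0 _] := hp.2 t Dt; have /andP[_ q1] := hq.2 t Dt.
  by apply: g_lt => //; exact: pq.
have Id := integrableB mD (utility_integrable _ hq) (utility_integrable _ hp).
have e0 : (\int[Lambda]_(t in D) `| (g (q t))%:E - (g (p t))%:E | = 0)%E.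
  under eq_integral => t Dt.
    rewrite gee0_abs; last by rewrite -EFinB lee_fin subr_ge0 ltW// gpq//
      -in_setE.
    over.
  rewrite -[LHS]fineK; last exact: (integrable_fin_num mD Id).
  have := @RintegralB _ _ _ Lambda D _ _ mD (utility_integrable _ hq)
    (utility_integrable _ hp).
  by rewrite -/(utility q) -/(utility p) e subrr /Rintegral /= => ->.
have := (ae_eq_integral_abs Lambda mD (measurable_int _ Id)).1 e0.
move=> [N [mN N0 sub]].
have : (Lambda D <= Lambda N)%E.
  apply: le_measure; rewrite ?inE//; apply: subset_trans sub => t Dt /= h.
  have := h Dt; have := gpq t Dt; rewrite -EFinB => + [].
  by rewrite -subr_gt0 => + e1; rewrite e1 ltxx.
by rewrite Lambda_D N0 lee_fin ler10.
Qed.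

Lemma utility_cvg (p_ : nat -> R -> R) p : (forall n, profile (p_ n)) ->
  profile p ->
  (forall t, D t -> p_ n t @[n --> \oo] --> p t) ->
  utility (p_ n) @[n --> \oo] --> utility p.
Proof.
move=> h_ h cv; apply: fine_cvg; rewrite fineK; last first.
  exact: (integrable_fin_num mD (utility_integrable _ h)).
have m_ n : measurable_fun (D : set (measurableTypeR R)) (fun t => (g (p_ n
  t))%:E).
  by apply/measurable_EFinP; apply: mgp.
have m : measurable_fun (D : set (measurableTypeR R)) (fun t => (g (p t))%:E)
  by apply/measurable_EFinP; apply: mgp.
have cv' : {ae Lambda, forall t, D t ->
    (g (p_ n t))%:E @[n --> \oo] --> (g (p t))%:E}.
  apply: aeW => t Dt; apply: cvg_EFin; first exact: nearW.
  have A : `[0, 1]%classic (p t) by rewrite /= in_itv/= h.2.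
  apply: (@cvg_comp _ _ _ (fun n => p_ n t) g _ _ _ _
    ((subspace_continuousP _ _).1 g_cont (p t) A)) => U W.
  have W' : \forall n \near \oo, `[0, 1]%classic (p_ n t) -> U (p_ n t) :=
    cv t Dt _ W.
  apply: filterS W' => n /=; apply.
  by rewrite in_itv/= (h_ n).2.
have dom : {ae Lambda, forall t n, D t -> (`|(g (p_ n t))%:E| <= cst M%:E t)%E}.
  by apply: aeW => t n Dt; rewrite /= lee_fin g_bound// (h_ n).2.
have IM : Lambda.-integrable D (cst M%:E) by exact:
  finite_measure_integrable_cst.
have [_ _ ] := @dominated_convergence _ (measurableTypeR R) R Lambda D mD
  (fun n t => (g (p_ n t))%:E) (fun t => (g (p t))%:E) (cst M%:E) m_ m cv' IM
    dom.
exact.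
Qed.

End utility.

Lemma increasing_utility {R : realType} (g : R -> R) :
  (forall t : R, 0 < t < 1 ->
    derivable g t 1 /\ {for t, continuous (derive1 g)}) ->
  g t @[t --> 0^'+] --> g 0 -> g t @[t --> 1^'-] --> g 1 ->
  (forall t : R, 0 < t < 1 -> 0 < (derive1 g) t) ->
  {within `[0, 1], continuous g} /\
  (forall x y, 0 <= x -> x < y -> y <= 1 -> g x < g y).
Proof.
move=> g_C1 g0 g1 g_incr.
have gc : {within `[0, 1], continuous g}.
  apply/continuous_within_itvP; first exact: ltr01.
  split=> // t; rewrite in_itv/= => /g_C1[dg _].
  exact/differentiable_continuous/derivable1_diffP.
split; first exact: gc.
have dg t : t \in `]0, 1[%R -> derivable g t 1.
  by rewrite in_itv => th; exact: (g_C1 t th).1.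
have dg_gt0 t : t \in `]0, 1[%R -> 0 < derive1 g t.
  by rewrite in_itv => th; exact: (g_incr t th).
move=> x y x0 xy y1.
have x01 : x \in `[0, 1]%R by rewrite in_itv/= x0 (le_trans (ltW xy) y1).
have y01 : y \in `[0, 1]%R by rewrite in_itv/= y1 (le_trans x0 (ltW xy)).
exact: (gtr0_derive1_lt_cc dg dg_gt0 gc x01 y01 xy).
Qed.

(** * Powers of two-tailed tests *)

Section two_tailed_power.
Context {d : measure_display} {Y : measurableType d} {R : realType}.
Variables (mu : {measure set Y -> \bar R}) (h T : Y -> R) (a b K : R).
Hypotheses (h_meas : measurable_fun setT h) (h_ge0 : forall y, 0 <= h y).
Hypothesis T_meas : measurable_fun setT T.
Hypotheses (le_ab : a <= b) (abK : Num.max `|a| `|b| < K).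
Hypothesis Theta_D : `[- K, K] `<=` natural_domain mu h T.
Hypothesis f_density : forall theta : R, - K <= theta <= K ->
  (\int[mu]_y (density mu h T theta y)%:E)%E = 1%E.
Implicit Types (theta s v : R) (delta : Y -> R).

Local Notation P := (power mu h T).
Local Notation f := (density mu h T a).
Local Notation x := (chart a b).
Local Notation lowr := (lower mu T f).
Local Notation tail2 := (two_tail mu T f).

Let absaK : - K < a < K.
Proof.
by move: abK; rewrite gt_max => /andP[]; rewrite ltr_norml.
Qed.

Let absbK : - K < b < K.
Proof.
by move: abK; rewrite gt_max => /andP[_]; rewrite ltr_norml.
Qed.

Let aK : - K <= a <= K.
Proof. by have /andP[/ltW -> /ltW ->] := absaK. Qed.

Let bK : - K <= b <= K.
Proof. by have /andP[/ltW -> /ltW ->] := absbK. Qed.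

Let f_ge0 : forall y, 0 <= f y. Proof. exact: (density_ge0 mu h T K). Qed.
Let f_L1 : L1 mu f. Proof. exact: (density_L1 mu h T K). Qed.
Let f_prob : pairing mu (fun=> 1) f = 1. Proof. exact: (power1 mu h T K). Qed.
Let lowr_rule s : decision_rule (lowr s). Proof. exact: lower_rule. Qed.

Let tL1 theta : - K <= theta <= K -> L1 mu (fun y => expR ((theta - a) * T y) *
  f y).
Proof. by move=> th; exact: (tilt_L1 mu h T K). Qed.

Lemma measurable_chart : measurable_fun setT (fun y => x (T y)).
Proof.
rewrite /chart; case: eqP => _; first exact: T_meas.
exact: measurable_expR_scale.
Qed.

(** Only the case [a = b] needs an argument: [a] is interior to [[- K, K]], and
    [r * `|t| <= expR (r * t) + expR (- r * t)] bounds [T * f] by two densities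
    of the family. *)
Lemma chart_L1 : L1 mu (fun y => x (T y) * f y).
Proof.
rewrite /chart; case: eqP => [_|_]; last exact: tL1.
have [r r0 [r1 r2]] : exists2 r, 0 < r & - K <= a - r <= K /\ - K <= a + r <= K.
  (* The distance from [a] to the complement of the parameter space. *)
  have /andP[K1 K2] := absaK; exists (Num.min (K - a) (a + K)).
    by rewrite lt_min; lra.
  by case: (leP (K - a) (a + K)) => ?; split; lra.
have := L1Z mu r^-1 _ (L1D mu _ _ (tL1 _ r1) (tL1 _ r2)).
apply: L1_le; first by apply: measurable_funM => //; exact: L1_measurable f_L1.
move=> y; rewrite normrM (ger0_norm (f_ge0 y)) -mulrDl mulrA ler_wpM2r//.
rewrite ler_pdivlMl// addrAC subrr sub0r (addrAC a) subrr add0r.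
have e1 := expR_ge1Dx (r * T y); have e2 := expR_ge1Dx (- r * T y).
have p1 := expR_gt0 (r * T y); have p2 := expR_gt0 (- r * T y).
move: e1 e2 p1 p2; rewrite mulNr.
move: (expR (r * T y)) (expR (- (r * T y))) => E F e1 e2 p1 p2.
by case: (leP 0 (T y)) => Ty; [rewrite ger0_norm|rewrite ltr0_norm]; lra.
Qed.

(** Agreement on [f] and on [x * f] implies agreement of the powers at [b], whether
    or not [a = b]. *)
Lemma power_b_chart : exists2 p : R * R, 0 <= p.1 /\ 0 <= p.2 &
  forall delta, test_function delta -> P b delta =
    p.1 * P a delta + p.2 * pairing mu delta (fun y => x (T y) * f y).
Proof.
rewrite /chart; case: eqP => [<-|_].
  by exists (1, 0) => //= delta _; rewrite mul1r mul0r addr0.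
have na := normalizer_gt0 mu h T K h_ge0 f_density _ aK.
have nb := normalizer_gt0 mu h T K h_ge0 f_density _ bK.
exists (0, normalizer mu h T b / normalizer mu h T a) => /=.
  by split; [exact: lexx|exact: divr_ge0 (ltW nb) (ltW na)].
by move=> delta td; rewrite mul0r add0r; exact: (power_tilt mu h T K).
Qed.

Lemma power_lower_continuous theta : - K <= theta <= K ->
  continuous (fun s => P theta (lowr s)).
Proof.
move=> th; have n0 := normalizer_gt0 mu h T K h_ge0 f_density.
have -> : (fun s => P theta (lowr s)) = (fun s =>
    normalizer mu h T theta / normalizer mu h T a *
    pairing mu (lowr s) (fun y => expR ((theta - a) * T y) * f y)).
  apply/funext => s; apply: (power_tilt mu h T K) => //.
  exact/decision_rule_test/lowr_rule.
move=> s; apply: cvgMr; apply: lower_continuous => //; last exact: tL1.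
exact: measurable_expR_scale.
Qed.

Lemma power_two_tail theta s v : - K <= theta <= K ->
  P theta (tail2 s v) = 1 - (P theta (lowr v) - P theta (lowr s)).
Proof.
move=> th; have LD := density_L1 mu h T K h_meas h_ge0 T_meas Theta_D _ th.
rewrite !powerE pairing_two_tail//; congr (_ - _).
exact: (power1 mu h T K).
Qed.

(** A rule of power 0 at [a] is null, and [two_tail 0 1] then replaces it; all other
    rules satisfy the hypothesis of [two_tail_matches]. *)
Lemma power_two_tail_matches delta : decision_rule delta -> P a delta < 1 ->
  exists s v, [/\ 0 <= s, s < v <= 1, P a (tail2 s v) = P a delta,
    P b (tail2 s v) = P b delta & forall theta, - K <= theta <= K ->
    theta < a \/ b < theta -> P theta delta <= P theta (tail2 s v)].
Proof.
move=> rd P1; have td := decision_rule_test _ rd.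
have /andP[P0 _] := power_itv mu h T K h_meas h_ge0 T_meas Theta_D f_density _
  _ aK rd.
move: P0; rewrite le_eqVlt => /predU1P[P0|P0].
  have r2 : decision_rule (tail2 0 1) by exact: two_tail_rule.
  have e0 : P a (tail2 0 1) = 0.
    by rewrite power_two_tail// !powerE !lower_mass ?lexx ?ler01// subr0 subrr.
  have nul theta e : - K <= theta <= K -> decision_rule e -> P a e = 0 ->
      P theta e = 0 by move=> *; apply: (power_null mu h T K _ _ _ _ _ _ a).
  exists 0, 1; split.
  - exact: lexx.
  - by rewrite ltr01 lexx.
  - by rewrite e0 P0.
  - by rewrite (nul b _ bK r2 e0) (nul b _ bK rd (esym P0)).
  - by move=> theta th _; rewrite (nul _ _ th r2 e0) (nul _ _ th rd (esym P0)).
have [||s [v [s0 sv v1 e0 ex]]] := two_tail_matches mu T f T_meas f_ge0 f_L1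
  f_prob
  x _ measurable_chart chart_L1 delta rd _.
- by move=> s t; exact: chart_incr.
- by rewrite P0 P1.
have r2 : decision_rule (tail2 s v) by apply: two_tail_rule => //; exact: ltW.
have t2 := decision_rule_test _ r2.
exists s, v; split; [exact: s0|by rewrite sv|exact: e0| |].
  by have [p _ Eb] := power_b_chart; rewrite !Eb// ex !powerE e0.
move=> theta th out.
rewrite !(power_tilt mu h T K h_meas h_ge0 T_meas Theta_D f_density _ a)//.
apply: ler_wpM2l.
  by rewrite divr_ge0 ?ltW// (normalizer_gt0 mu h T K).
apply: (two_tail_dominates mu T f T_meas f_ge0 f_L1 f_prob x _ chart_L1
  (fun t => expR ((theta - a) * t))) => //.
- by move=> ? ?; exact: chart_incr.
- by move=> l u lu; exact: separation_outside.
- exact: tL1.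
Qed.

(** Apply [two_tail_quasiconvex] with [beta] equal to the right-hand side. *)
Lemma power_two_tail_quasiconvex theta s v : a <= theta <= b ->
  0 <= s -> s < v -> v <= 1 ->
  P theta (tail2 s v) <= Num.max (P a (tail2 s v)) (P b (tail2 s v)).
Proof.
move=> th s0 sv v1.
have := le_ab; rewrite le_eqVlt => /predU1P[ab|ab].
  have -> : theta = a by apply/eqP; rewrite eq_le andbC {2}ab.
  rewrite le_max; apply/orP; left; exact: lexx.
have r2 : decision_rule (tail2 s v) by apply: two_tail_rule => //; exact: ltW.
set beta := Num.max _ _.
have thK : - K <= theta <= K.
  case/andP: th => t1 t2; case/andP: aK => a1 _; case/andP: bK => _ b2.
  by rewrite (le_trans a1)// (le_trans t2).
have itv := power_itv mu h T K h_meas h_ge0 T_meas Theta_D f_density _ _ _ r2.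
have b01 : 0 <= beta <= 1.
  have /andP[a0 a1] := itv _ aK; have /andP[_ b1] := itv _ bK.
  move: (P a _) (P b _) @beta a0 a1 b1 => pa pb beta pa0 pa1 pb1.
  by rewrite /beta le_max ge_max pa0 pa1 pb1.
have rb : decision_rule (fun _ : Y => beta).
  by split=> [|y]; [exact: measurable_cst|].
have tt := decision_ruleB _ _ r2 rb.
have t2 := decision_rule_test _ r2; have tb := decision_rule_test _ rb.
have PB t : - K <= t <= K ->
    P t (fun y => tail2 s v y - beta) = P t (tail2 s v) - beta.
  move=> tK; rewrite powerE pairingBl//; last exact: (density_L1 mu h T K).
  by congr (_ - _); exact: (power_cst mu h T K).
have tilt t : - K <= t <= K -> P t (fun y => tail2 s v y - beta) =
    normalizer mu h T t / normalizer mu h T a *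
    pairing mu (fun y => tail2 s v y - beta) (fun y => expR ((t - a) * T y) * f
      y).
  by move=> tK; exact: (power_tilt mu h T K).
have ratio t : - K <= t <= K -> 0 < normalizer mu h T t / normalizer mu h T a.
  by move=> tK; rewrite divr_gt0 // (normalizer_gt0 mu h T K).
rewrite -subr_le0 -PB// tilt// pmulr_rle0 ?ratio//.
apply: (two_tail_quasiconvex mu T f T_meas f_ge0 f_L1 f_prob x _
  (fun t => expR ((theta - a) * t))) => //.
- exact: chart_L1.
- by move=> l u lu ly uy; exact: separation_inside.
- exact: tL1.
- by have := PB _ aK; rewrite powerE => ->; rewrite subr_le0 le_max lexx.
- have := tilt _ bK; rewrite PB// => e.
  have : P b (tail2 s v) - beta <= 0 by rewrite subr_le0 le_max lexx orbT.
  by rewrite e pmulr_rle0 ?ratio// /chart lt_eqF.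
Qed.

End two_tailed_power.

(** * Existence of an optimal two-tailed test *)

Section optimal_two_tail.
Context {d : measure_display} {Y : measurableType d} {R : realType}.
Variables (mu : {measure set Y -> \bar R}) (h T : Y -> R) (a b K alpha : R).
Hypotheses (h_meas : measurable_fun setT h) (h_ge0 : forall y, 0 <= h y).
Hypothesis T_meas : measurable_fun setT T.
Hypotheses (le_ab : a <= b) (abK : Num.max `|a| `|b| < K).
Hypothesis Theta_D : `[- K, K] `<=` natural_domain mu h T.
Hypothesis f_density : forall theta : R, - K <= theta <= K ->
  (\int[mu]_y (density mu h T theta y)%:E)%E = 1%E.
Hypothesis alpha01 : 0 < alpha < 1.
Variables (g : R -> R) (Lambda : probability (measurableTypeR R) R).
Hypotheses (mg : measurable_fun (`[0, 1] : set R) g)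
  (g_cont : {within `[0, 1], continuous g})
  (g_lt : forall x y, 0 <= x -> x < y -> y <= 1 -> g x < g y).
Hypothesis Lambda_Theta1 : Lambda (`[- K, K] `\` `[a, b]) = 1%E.
Implicit Types (theta s v : R) (delta : Y -> R).

Local Notation P := (power mu h T).
Local Notation f := (density mu h T a).
Local Notation tail2 := (two_tail mu T f).
Local Notation Theta1 := (`[- K, K] `\` `[a, b]).
Local Notation U delta := (utility g Lambda Theta1 (fun theta => P theta
  delta)).

Let abs_aK : - K <= a <= K.
Proof.
by move: abK; rewrite gt_max => /andP[];
  rewrite ltr_norml => /andP[/ltW -> /ltW ->].
Qed.

Let abs_bK : - K <= b <= K.
Proof.
by move: abK; rewrite gt_max => /andP[_];
  rewrite ltr_norml => /andP[/ltW -> /ltW ->].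
Qed.

Let abK' theta : a <= theta <= b -> - K <= theta <= K.
Proof.
case/andP => t1 t2; case/andP: abs_aK => a1 _; case/andP: abs_bK => _ b2.
by rewrite (le_trans a1)// (le_trans t2).
Qed.

Let mTheta1 : measurable (Theta1 : set (measurableTypeR R)).
Proof. by apply: measurableD; exact: measurable_itv. Qed.

Let Theta1K theta : Theta1 theta ->
  - K <= theta <= K /\ (theta < a \/ b < theta).
Proof.
move=> [] /=; rewrite !in_itv/= => th /negP; rewrite negb_and -!ltNge.
by move=> /orP.
Qed.

Let f_ge0 : forall y, 0 <= f y. Proof. exact: (density_ge0 mu h T K). Qed.
Let f_L1 : L1 mu f. Proof. exact: (density_L1 mu h T K). Qed.
Let f_prob : pairing mu (fun=> 1) f = 1. Proof. exact: (power1 mu h T K). Qed.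

Let tail_rule s v : 0 <= s -> s <= v -> v <= 1 -> decision_rule (tail2 s v).
Proof. exact: two_tail_rule. Qed.

Let P01 theta delta : - K <= theta <= K -> decision_rule delta -> 0 <= P theta
  delta <= 1.
Proof. exact: (power_itv mu h T K). Qed.

Lemma power_profile delta : decision_rule delta ->
  profile Theta1 (fun theta => P theta delta).
Proof.
move=> rd; split; last by move=> t /Theta1K[tK _]; exact: P01.
have : measurable_fun (`[- K, K] : set R) (fun theta => P theta delta).
  apply: subspace_continuous_measurable_fun; first exact: measurable_itv.
  exact: (power_continuous mu h T K).
by apply: measurable_funS; [exact: measurable_itv|exact: subDsetl].
Qed.

Lemma objectiveE delta : decision_rule delta ->
  objective mu h T g Lambda Theta1 delta = (U delta)%:E.
Proof.
by move=> rd; apply: utility_EFin => //; exact: power_profile.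
Qed.

Let power_pair_continuous theta : - K <= theta <= K ->
  continuous (fun p : R * R => P theta (tail2 p.1 p.2)).
Proof.
move=> tK.
have -> : (fun p : R * R => P theta (tail2 p.1 p.2)) =
    (fun p => 1 - (P theta (lower mu T f p.2) - P theta (lower mu T f p.1))).
  by apply/funext => p; exact: (power_two_tail mu h T a b K).
have cl := power_lower_continuous mu h T a b K h_meas h_ge0 T_meas abK Theta_D
  f_density theta tK.
move=> p; apply: cvgB; first exact: cvg_cst.
apply: cvgB.
  apply: (@continuous_comp _ _ _ (fun p : R * R => p.2)
    (fun s => P theta (lower mu T f s))); [exact: cvg_snd|exact: cl].
apply: (@continuous_comp _ _ _ (fun p : R * R => p.1)
    (fun s => P theta (lower mu T f s))); [exact: cvg_fst|exact: cl].
Qed.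

Let feasible : set (R * R) := [set p | [/\ 0 <= p.1, p.1 <= p.2, p.2 <= 1,
  P a (tail2 p.1 p.2) <= alpha & P b (tail2 p.1 p.2) <= alpha]].

Let feasible_compact : compact feasible.
Proof.
have cl_le (F : R * R -> R) (c : R) : continuous F -> closed [set p | F p <= c].
  move=> cF; apply: (@closed_comp _ _ F [set r | r <= c]).
    by move=> p _; exact: cF.
  exact: closed_le.
have c1 : continuous (fun p : R * R => p.1) by move=> p; exact: cvg_fst.
have c2 : continuous (fun p : R * R => p.2) by move=> p; exact: cvg_snd.
have -> : feasible = (`[0, 1] `*` `[0, 1]) `&` ([set p | p.1 - p.2 <= 0] `&`
    ([set p | P a (tail2 p.1 p.2) <= alpha] `&` [set p | P b (tail2 p.1 p.2) <=
      alpha])).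
  apply/seteqP; split=> -[s v] /=; rewrite !in_itv/= subr_le0.
    move=> [s0 sv v1 ea eb]; rewrite s0 v1 (le_trans s0 sv) (le_trans sv v1).
    exact: (conj (conj isT isT) (conj sv (conj ea eb))).
  by move=> [[/andP[s0 _] /andP[_ v1]] [sv [ea eb]]];
    exact: And5 s0 sv v1 ea eb.
apply: compact_closedI; first by apply: compact_setX; exact: segment_compact.
apply: closedI; last by apply: closedI; apply: cl_le;
  exact: power_pair_continuous.
by apply: cl_le => p; apply: cvgB; [exact: c1|exact: c2].
Qed.

(** A feasible rule is dominated by a two-tailed test with the same powers at [a]
    and [b], which is feasible too; so it is enough to maximize over the compact
    set of feasible two-tailed tests. Here feasibility is imposed at [a] and [b]
    only. *)
Lemma two_tail_optimum : exists s v, [/\ 0 <= s, s < v <= 1,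
  P a (tail2 s v) <= alpha, P b (tail2 s v) <= alpha &
  forall delta, decision_rule delta -> P a delta <= alpha -> P b delta <= alpha
    ->
    U delta <= U (tail2 s v)].
Proof.
have /andP[al0 al1] := alpha01.
have match_ delta (rd : decision_rule delta) (le : P a delta < 1) :=
  power_two_tail_matches mu h T a b K h_meas h_ge0 T_meas le_ab abK Theta_D
    f_density delta rd le.
have r0 : decision_rule (fun _ : Y => 0 : R).
  by split=> [|y]; [exact: measurable_cst|rewrite lexx ler01].
have P0 theta : - K <= theta <= K -> P theta (fun=> 0) = 0.
  by move=> tK; exact: (power_cst mu h T K).
have F0 : feasible !=set0.
  have [|s [v [s0 /andP[sv v1] ea eb _]]] := match_ _ r0; first by rewrite P0.
  exists (s, v); apply: And5;
    rewrite /= ?ea ?eb ?(P0 _ abs_aK) ?(P0 _ abs_bK);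
    [exact: s0|exact: ltW sv|exact: v1|exact: ltW al0|].
  exact: ltW al0.
have cU : {within feasible, continuous (fun p => U (tail2 p.1 p.2))}.
  apply: within_continuous_seq => u p uF pF up.
  have prof q : feasible q -> profile Theta1 (fun theta => P theta (tail2 q.1
    q.2)).
    by case=> q0 q12 q1 _ _; apply: power_profile; exact: tail_rule.
  apply: (utility_cvg g Lambda Theta1) => //.
  - by move=> n; exact: (prof (u n) (uF n)).
  - exact: (prof p pF).
  move=> theta /Theta1K[tK _].
  exact: (cvg_comp _ _ up (power_pair_continuous theta tK p)).
have [[s v]] := compact_EVT_max F0 feasible_compact cU.
move=> /set_mem[s0 sv v1 ea eb] opt.
rewrite /fst /snd in s0 sv v1 ea eb.
(* [s = v] is the constant rule 1, which is not feasible. *)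
have svlt : s < v.
  rewrite lt_neqAle sv andbT; apply/eqP => e.
  move: ea; rewrite (power_two_tail mu h T a b K)// e subrr subr0; lra.
exists s, v; split; [exact: s0|by rewrite svlt|exact: ea|exact: eb|].
move=> delta rd da db.
have [|s' [v' [s0' /andP[sv' v1'] ea' eb' dom]]] := match_ _ rd.
  exact: le_lt_trans da al1.
have fe : feasible (s', v').
  by apply: And5; rewrite /= ?ea' ?eb';
    [exact: s0'|exact: ltW sv'|exact: v1'| |].
apply: (le_trans _ (opt (s', v') _)); last by rewrite inE.
apply: utility_le => //; first exact: power_profile.
  by apply: power_profile; apply: tail_rule => //; exact: ltW.
by move=> theta /Theta1K[tK out]; exact: dom.
Qed.

Lemma power_le_test_size theta delta : decision_rule delta -> a <= theta <= b ->
  P theta delta <= test_size mu h T `[a, b] delta.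
Proof.
move=> rd th; apply: ub_le_sup.
  exists 1 => _ [t + <-]; rewrite /= in_itv/= => tab.
  by have /andP[] := P01 _ _ (abK' _ tab) rd.
by exists theta => //; rewrite /= in_itv.
Qed.

Lemma test_size_le (c : R) delta :
  (forall theta, a <= theta <= b -> P theta delta <= c) ->
  test_size mu h T `[a, b] delta <= c.
Proof.
move=> le; apply: ge_sup.
  by exists (P a delta), a => //; rewrite /= in_itv/= lexx.
by move=> _ [t + <-]; rewrite /= in_itv/=; exact: le.
Qed.

(** If both end-point powers were below [alpha], mixing the test with the rule 1
    could bring their maximum up to [alpha]; the mixture still satisfies the two
    constraints of [two_tail_optimum] and is strictly more powerful wherever the
    power is below 1. The power is below 1 everywhere, for otherwise the rule
    would be 1 almost everywhere and its power at [a] would be 1. *)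
Lemma two_tail_optimal_rule : exists s v, [/\ 0 <= s, s < v <= 1,
  optimal_rule mu h T g Lambda `[a, b] Theta1 alpha (tail2 s v),
  test_size mu h T `[a, b] (tail2 s v) = alpha &
  alpha = Num.max (P a (tail2 s v)) (P b (tail2 s v))].
Proof.
have [s [v [s0 /andP[sv v1] ea eb opt]]] := two_tail_optimum.
have /andP[al0 al1] := alpha01.
have r2 : decision_rule (tail2 s v) by apply: tail_rule => //; exact: ltW.
have qc theta : a <= theta <= b ->
    P theta (tail2 s v) <= Num.max (P a (tail2 s v)) (P b (tail2 s v)).
  by move=> th; exact: (power_two_tail_quasiconvex mu h T a b K).
have aab : a <= a <= b by rewrite lexx.
have bab : a <= b <= b by rewrite lexx andbT.
have endpoints delta : decision_rule delta ->
    test_size mu h T `[a, b] delta <= alpha ->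
    P a delta <= alpha /\ P b delta <= alpha.
  move=> rd sz; split; apply: le_trans sz.
    exact: power_le_test_size rd aab.
  exact: power_le_test_size rd bab.
have size_le : test_size mu h T `[a, b] (tail2 s v) <= alpha.
  by apply: test_size_le => theta th; rewrite (le_trans (qc _ th))// ge_max ea.
have maxE : alpha = Num.max (P a (tail2 s v)) (P b (tail2 s v)).
  apply/eqP; rewrite eq_le; apply/andP; split; last by rewrite ge_max ea.
  rewrite leNgt; apply/negP.
  set beta := Num.max _ _ in qc * => lt.
  have b1 : 0 < 1 - beta by rewrite subr_gt0 (lt_trans lt).
  (* The weight of the rule 1 that brings the larger end-point power to [alpha]. *)
  pose e := (alpha - beta) / (1 - beta).
  have e0 : 0 < e by rewrite divr_gt0// subr_gt0.
  have e1 : e < 1 by rewrite ltr_pdivrMr// mul1r ltrD2r.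
  pose mix y := e + (1 - e) * tail2 s v y.
  have rmix : decision_rule mix.
    split; first by apply: measurable_funD => //;
      apply: measurable_funM => //; case: r2.
    by move=> y; have /andP[t0 t1] := r2.2 y; rewrite /mix; nra.
  have Pmix theta : - K <= theta <= K ->
      P theta mix = P theta (tail2 s v) + e * (1 - P theta (tail2 s v)).
    move=> tK.
    have LD := density_L1 mu h T K h_meas h_ge0 T_meas Theta_D _ tK.
    have re : decision_rule (fun _ : Y => e).
      by split=> [|y]; [exact: measurable_cst|rewrite !ltW].
    have t2 := decision_rule_test _ r2.
    have Le := L1_test _ _ _ (decision_rule_test _ re) LD.
    have -> : P theta mix = P theta (fun=> e) + (1 - e) * P theta (tail2 s v).
      rewrite !powerE -pairingZl// /pairing -RintegralD//.
        by apply: eq_Rintegral => y _; rewrite mulrDl.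
      rewrite (_ : (EFin \o _) = EFin \o (fun y => (1 - e) * (tail2 s v y *
        density mu h T theta y))).
        exact/L1Z/L1_test.
      by apply/funext => y /=; rewrite mulrA.
    by rewrite (power_cst mu h T K)//; ring.
  have Pmix_le theta : - K <= theta <= K -> P theta (tail2 s v) <= beta ->
      P theta mix <= alpha.
    move=> tK le; rewrite Pmix//.
    have -> : alpha = beta + e * (1 - beta) by rewrite divfK ?gt_eqF// subrKC.
    move: (P theta (tail2 s v)) le => p le; nra.
  have : U mix <= U (tail2 s v).
    apply: opt rmix _ _.
      by apply: (Pmix_le _ abs_aK); rewrite /beta le_max; apply/orP; left;
        exact: lexx.
    by apply: (Pmix_le _ abs_bK); rewrite /beta le_max; apply/orP; right;
      exact: lexx.
  rewrite leNgt => /negP; apply.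
  apply: (utility_lt g Lambda Theta1) => //; [exact: power_profile..|].
  move=> theta /Theta1K[tK _]; rewrite Pmix// ltrDl mulr_gt0// subr_gt0.
  have /andP[_] := P01 _ _ tK r2; rewrite le_eqVlt => /predU1P[one|//].
  have rc : decision_rule (fun y => 1 - tail2 s v y).
    split; first by apply: measurable_funB => //; case: r2.
    by move=> y; have /andP[t0 t1] := r2.2 y; rewrite subr_ge0 t1 gerBl.
  have Pc t : - K <= t <= K -> P t (fun y => 1 - tail2 s v y) = 1 - P t (tail2
    s v).
    move=> tK'; rewrite powerE pairingBl//.
    - by congr (_ - _); exact: (power1 mu h T K).
    - by split=> [|y]; [exact: measurable_cst|rewrite normr1].
    - exact: decision_rule_test.
    - exact: (density_L1 mu h T K).
  have := power_null mu h T K h_meas h_ge0 T_meas Theta_D f_density a theta _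
    tK abs_aK rc.
  rewrite !Pc// one subrr => /(_ erefl)/eqP.
  by rewrite subr_eq0 => /eqP e1'; move: ea; rewrite -e1' leNgt al1.
exists s, v; split; [exact: s0|by rewrite sv| | |exact: maxE].
- split; [exact: r2|exact: size_le|move=> delta rd sz].
  rewrite (objectiveE _ rd) (objectiveE _ r2) lee_fin.
  by have [da db] := endpoints _ rd sz; exact: opt.
- apply/eqP; rewrite eq_le size_le/= {1}maxE ge_max.
  by rewrite (power_le_test_size _ _ r2 aab) (power_le_test_size _ _ r2 bab).
Qed.

End optimal_two_tail.

(** * Thresholds of the optimal rule *)

Section erasing.
Context {d : measure_display} {Y : measurableType d} {R : realType}.
Variables (mu : {measure set Y -> \bar R}) (h T : Y -> R) (K : R).
Hypotheses (h_meas : measurable_fun setT h) (h_ge0 : forall y, 0 <= h y).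
Hypothesis T_meas : measurable_fun setT T.
Hypothesis Theta_D : `[- K, K] `<=` natural_domain mu h T.
Hypothesis f_density : forall theta : R, - K <= theta <= K ->
  (\int[mu]_y (density mu h T theta y)%:E)%E = 1%E.

(** A set that is null for one density of the family is null for all of them. *)
Lemma erase_null_set (A : set Y) (delta : Y -> R) (theta0 : R) :
  measurable A -> decision_rule delta -> - K <= theta0 <= K ->
  ~ 0 < power mu h T theta0 \1_A ->
  decision_rule (fun y => (1 - \1_A y) * delta y) /\
  forall theta, - K <= theta <= K ->
    power mu h T theta (fun y => (1 - \1_A y) * delta y) =
    power mu h T theta delta.
Proof.
move=> mA rd t0 nA.
have rA : decision_rule (\1_A : Y -> R).
  by split=> [|y]; [exact: measurable_indic|rewrite indicE; case: (_ \in _);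
    rewrite /= ?ler01 ?lexx].
have re : decision_rule (fun y => (1 - \1_A y) * delta y).
  split; first by apply: measurable_funM; [apply: measurable_funB => //;
    case: rA|case: rd].
  move=> y; have /andP[d0 d1] := rd.2 y; rewrite indicE; case: (_ \in _) => /=.
    by rewrite subrr mul0r lexx ler01.
  by rewrite subr0 mul1r d0.
split=> // theta tK.
have A0 : power mu h T theta0 \1_A = 0.
  apply/eqP; rewrite eq_le leNgt; move/negP: nA => ->/=.
  by have /andP[] := power_itv mu h T K h_meas h_ge0 T_meas Theta_D f_density _
    _ t0 rA.
have LD t := density_L1 mu h T K h_meas h_ge0 T_meas Theta_D t.
apply/esym/eqP; rewrite -subr_eq0 !powerE -pairingBl; last exact: LD.
- apply/eqP; apply: (pairing_null mu \1_A _ (density mu h T theta0)).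
  + exact: decision_rule_test.
  + exact: LD.
  + exact: decision_ruleB.
  + exact: LD.
  + by move=> y; apply: mulr_ge0;
    [case/andP: (rA.2 y)|exact: (density_ge0 mu h T K)].
  + exact: A0.
  move=> y e0; rewrite (density_tilt mu h T K h_ge0 f_density theta theta0 t0).
  move: e0; move: (\1_A y) (delta y) (density mu h T theta0 y) (_ / _) (expR _).
  move=> i D f0 r E e0; rewrite (_ : _ * _ = D * r * E * (i * f0));
    last by ring.
  by rewrite e0 mulr0.
- exact: decision_rule_test.
- exact: decision_rule_test.
Qed.

End erasing.

Section shape.
Context {d : measure_display} {Y : measurableType d} {R : realType}.
Variables (mu : {measure set Y -> \bar R}) (h T : Y -> R) (a b K alpha : R).
Hypotheses (h_meas : measurable_fun setT h) (h_ge0 : forall y, 0 <= h y).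
Hypothesis T_meas : measurable_fun setT T.
Hypotheses (le_ab : a <= b) (abK : Num.max `|a| `|b| < K).
Hypothesis Theta_D : `[- K, K] `<=` natural_domain mu h T.
Hypothesis f_density : forall theta : R, - K <= theta <= K ->
  (\int[mu]_y (density mu h T theta y)%:E)%E = 1%E.
Local Notation P := (power mu h T).
Local Notation f := (density mu h T a).
Local Notation tail2 := (two_tail mu T f).

Let abK' theta : a <= theta <= b -> - K <= theta <= K.
Proof.
move: abK; rewrite gt_max !ltr_norml => /andP[/andP[Ka _] /andP[_ bK]].
by case/andP => t1 t2; rewrite (le_trans (ltW Ka))// (le_trans t2)// ltW.
Qed.

(** Only coinciding thresholds [l = u = c] need care. The test is then 1 off
    [T = c], so that the bound on its size gives the atom mass at least
    [1 - alpha]. If the atom is not approached from both sides, there is a null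
    interval next to it, on which the test may be replaced by 0; that interval
    separates the thresholds. *)
Lemma two_tail_shape s v : 0 <= s -> s < v <= 1 ->
  (forall theta, a <= theta <= b -> P theta (tail2 s v) <= alpha) ->
  exists delta, [/\ decision_rule delta,
    forall theta, - K <= theta <= K -> P theta delta = P theta (tail2 s v) &
    exists l u : \bar R,
      ((l < u)%E \/ (exists c : R, [/\ l = c%:E, u = c%:E &
         dominant_inner_atom mu h T `[a, b] alpha c])) /\
      two_sided T l u delta delta].
Proof.
move=> s0 /andP[sv v1] size.
have aK : - K <= a <= K by apply: abK'; rewrite lexx.
have f_ge0 := density_ge0 mu h T K h_ge0 f_density a aK.
have f_L1 := density_L1 mu h T K h_meas h_ge0 T_meas Theta_D a aK.
have f_prob := power1 mu h T K f_density a aK.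
have r2 := two_tail_rule mu T f T_meas f_ge0 f_L1 f_prob _ _ s0 (ltW sv) v1.
have [lu _] := lower_mono mu T f T_meas f_ge0 f_L1 f_prob _ _ s0 sv v1.
have ly := quantile_ltey mu T f T_meas f_ge0 f_L1 f_prob _ (lt_le_trans sv v1).
have uy := quantile_gtNy mu T f T_meas f_ge0 f_L1 f_prob _ (le_lt_trans s0 sv).
have shape y := two_tailE mu T f _ _ y lu.
move: shape lu ly uy.
set l := (quantile mu T f s).1; set u := (quantile mu T f v).1.
move: l u => l u shape; rewrite le_eqVlt => /predU1P[|lu _ _]; last first.
  exists (tail2 s v); split; [exact: r2|by []|exists l, u; split;
    first by left].
  move=> y; have [out inn] := shape y.
  by apply: And3; [exact: out|by []|exact: inn].
case: l u shape => [c| |] [c'| |]// shape [ec] _ _; rewrite {}ec {c} in shape.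
(* From here on both thresholds are [c']. *)
have out y : T y <> c' -> tail2 s v y = 1.
  move=> /eqP; rewrite neq_lt => /orP[lt|lt]; apply: (shape y).1.
    by right; rewrite lte_fin.
  by left; rewrite lte_fin.
have mpre (A : set R) : measurable A -> measurable [set y | A (T y)].
  by move=> mA; have := T_meas measurableT A mA; rewrite setTI.
have atom theta : a <= theta <= b -> 1 - alpha <= P theta \1_[set y | T y = c'].
  move=> th; have tK := abK' _ th.
  have mA : measurable [set y | T y = c'] by exact: (mpre [set c']).
  have rA : decision_rule (\1_[set y | T y = c'] : Y -> R).
    by split=> [|y]; [exact: measurable_indic|rewrite indicE; case: (_ \in _);
      rewrite /= ?ler01 ?lexx].
  have LD := density_L1 mu h T K h_meas h_ge0 T_meas Theta_D _ tK.
  have t2 := decision_rule_test _ r2; have tA := decision_rule_test _ rA.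
  have one : decision_rule (fun _ : Y => 1 : R).
    by split=> [|y]; [exact: measurable_cst|rewrite ler01 lexx].
  have t1 := decision_rule_test _ one; have t1A := decision_ruleB _ _ one rA.
  have le := size _ th.
  suff : 1 - P theta \1_[set y | T y = c'] <= P theta (tail2 s v).
    by move=> le2; have := le_trans le2 le;
      rewrite lerBlDl addrC -lerBlDl addrC.
  have -> : 1 - P theta \1_[set y | T y = c'] =
      P theta (fun y => 1 - \1_[set y | T y = c'] y).
    rewrite [RHS]powerE (pairingBl mu _ _ _ t1 tA LD); congr (_ - _).
    exact/esym/(power1 mu h T K).
  apply: le_Rintegral => //; [exact: L1_test|exact: L1_test|move=> y _].
  apply: ler_wpM2r; first exact: (density_ge0 mu h T K).
  rewrite indicE; case: (pselect (T y = c')) => Ty.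
    by rewrite mem_set//= subrr; case/andP: (r2.2 y).
  by rewrite memNset//= subr0 out.
have [dom|ndom] := pselect (dominant_inner_atom mu h T `[a, b] alpha c').
  exists (tail2 s v); split; [exact: r2|by []|exists c'%:E, c'%:E; split].
    by right; exists c'.
  move=> y; have [outy inny] := shape y.
  by apply: And3; [exact: outy|by []|exact: inny].
have [theta [e [tab eps0 nonpos]]] : exists theta e, [/\ a <= theta <= b, 0 < e
  &
    ~ (0 < P theta \1_[set y | c' - e < T y < c'] /\
       0 < P theta \1_[set y | c' < T y < c' + e])].
  apply: contrapT => none; apply: ndom => theta; rewrite /= in_itv/= => th.
  split; first exact: atom.
  by move=> e e0; apply: contrapT => np; apply: none; exists theta, e.
have tK := abK' _ tab.
have mgap p q : measurable [set y | p < T y < q].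
  rewrite (_ : [set _ | _] = [set y | `]p, q[%classic (T y)]).
    by apply: mpre; exact: measurable_itv.
  by apply/seteqP; split=> y /=; rewrite in_itv.
suff [p [q [pq pc gap]]] : exists p q, [/\ p < q, p = c' \/ q = c' &
    ~ 0 < P theta \1_[set y | p < T y < q]].
  have [re eP] := erase_null_set mu h T K h_meas h_ge0 T_meas Theta_D f_density
    [set y | p < T y < q] _ theta (mgap p q) r2 tK gap.
  exists (fun y => (1 - \1_[set y | p < T y < q] y) * tail2 s v y).
  split; [exact: re|exact: eP|exists p%:E, q%:E; split].
    by left; rewrite lte_fin.
  move=> y; apply: And3; [|by []|]; rewrite !lte_fin indicE.
  - move=> far; rewrite memNset/=; last by case/andP => py yq; case: far => far;
      [move: (lt_trans far yq)|move: (lt_trans far py)]; rewrite ltxx.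
    rewrite subr0 mul1r out// => Ty; case: far; rewrite Ty; case: pc => <-.
    + by rewrite ltNge (ltW pq).
    + by rewrite ltxx.
    + by rewrite ltxx.
    + by rewrite ltNge (ltW pq).
  - by move=> [py yq]; rewrite mem_set/= ?py// subrr mul0r.
have [neg|neg] : ~ 0 < P theta \1_[set y | c' - e < T y < c'] \/
    ~ 0 < P theta \1_[set y | c' < T y < c' + e].
- by apply/not_andP.
- by exists (c' - e), c'; split; [rewrite gtrBl|right|].
- by exists c', (c' + e); split; [rewrite ltrDl|left|].
Qed.

End shape.

(** * The optimal rule *)

Theorem theorem11 (R : realType) (d2 : nat) (hd2 : (1 <= d2)%N)
    (Y : set (d2.-tuple (measurableTypeR R))) (y0 : Y)
    (mu : {measure set (borel_subspace y0) -> \bar R})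
    (mu_sigma_finite : sigma_finite setT mu)
    (h T : borel_subspace y0 -> R)
    (h_meas : measurable_fun setT h) (h_ge0 : forall y, 0 <= h y)
    (T_meas : measurable_fun setT T)
    (a b K alpha : R) (le_ab : a <= b) (abK : Num.max `|a| `|b| < K)
    (D_open : open (natural_domain mu h T))
    (Theta_D : `[- K, K] `<=` natural_domain mu h T)
    (f_density : forall theta : R, - K <= theta <= K ->
       (\int[mu]_y (density mu h T theta y)%:E)%E = 1%E)
    (alpha01 : 0 < alpha < 1)
    (g : R -> R) (g_meas : measurable_fun (`[0, 1] : set R) g)
    (g_C1 : forall t : R, 0 < t < 1 -> derivable g t 1 /\ {for t, continuous (derive1 g)})
    (g_cont0 : g t @[t --> 0^'+] --> g 0)
    (g_cont1 : g t @[t --> 1^'-] --> g 1)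
    (g_incr : forall t : R, 0 < t < 1 -> 0 < (derive1 g) t)
    (Lambda1 : probability (measurableTypeR R) R)
    (Lambda1_Theta1 : Lambda1 (`[- K, K] `\` `[a, b]) = 1%E)
    (T_values : forall c1 c2 : R,
       (0 < mu [set y | T y <> c1 /\ T y <> c2])%E) :
  exists delta : borel_subspace y0 -> R,
    [/\ optimal_rule mu h T g Lambda1 `[a, b] (`[- K, K] `\` `[a, b]) alpha delta,
        test_size mu h T `[a, b] delta = alpha,
        alpha = Num.max (power mu h T a delta) (power mu h T b delta) &
        exists (l u : \bar R) (gamma : borel_subspace y0 -> R),
          [/\ (l < u)%E \/
                (exists c : R, [/\ l = c%:E, u = c%:E &
                   dominant_inner_atom mu h T `[a, b] alpha c]),
              decision_rule gamma &
              two_sided T l u gamma delta]].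
Proof.
have [g_cont g_lt] := increasing_utility g g_C1 g_cont0 g_cont1 g_incr.
have [s [v [s0 sv1 [r2 size_le opt] size maxE]]] := two_tail_optimal_rule mu h T a b K
  alpha h_meas h_ge0 T_meas le_ab abK Theta_D f_density alpha01 g Lambda1
  g_meas g_cont g_lt Lambda1_Theta1.
have [theta th|delta [rd Pd [l [u [lu shape]]]]] := two_tail_shape mu h T a b K alpha
  h_meas h_ge0 T_meas le_ab abK Theta_D f_density s v s0 sv1.
  rewrite -size; exact: (power_le_test_size mu h T a b K).
have abs_le theta : a <= theta <= b -> - K <= theta <= K.
  move: abK; rewrite gt_max !ltr_norml => /andP[/andP[Ka _] /andP[_ bK]].
  by case/andP => t1 t2; rewrite (le_trans (ltW Ka))// (le_trans t2)// ltW.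
have sizeE : test_size mu h T `[a, b] delta =
    test_size mu h T `[a, b] (two_tail mu T (density mu h T a) s v).
  congr sup; apply: eq_imagel => theta; rewrite /= in_itv/= => th.
  exact/Pd/abs_le.
have objE : objective mu h T g Lambda1 (`[- K, K] `\` `[a, b]) delta =
    objective mu h T g Lambda1 (`[- K, K] `\` `[a, b])
      (two_tail mu T (density mu h T a) s v).
  apply: eq_integral => theta /set_mem[]; rewrite /= in_itv/= => th _.
  by rewrite (Pd _ th).
exists delta; split.
- split; [exact: rd|by rewrite sizeE|].
  by move=> delta' rd' sz'; rewrite objE; exact: opt.
- by rewrite sizeE.
- by rewrite !Pd//; apply: abs_le; rewrite lexx ?andbT.
- by exists l, u, delta.
Qed.
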